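(* Let $T$ be a triangulation of a convex $(n+3)$-gon and let $\gamma$ be a diagonal of the polygon that is not in $T$. Then the face lattice of the Newton polytope $N(T,\gamma)$ (and likewise the face lattice of the perfect matching polytope $P(G_{T,\gamma})$) is isomorphic to the lattice of all elementary subgraphs of the snake graph $G_{T,\gamma}$, ordered by inclusion.
   Context: Setting. $T$ is a triangulation of a convex $(n+3)$-gon with diagonals $\tau_1,\dots,\tau_n$ and boundary segments $\tau_{n+1},\dots,\tau_{2n+3}$. Let $\mathcal{A}$ be the type $A$ cluster algebra with initial cluster variables $x_1,\dots,x_n$ (attached to $\tau_1,\dots,\tau_n$), frozen/coefficient variables $x_{n+1},\dots,x_{2n+3}$ (attached to the boundary segments), and initial quiver $Q_T$ (vertices at midpoints of the $\tau_i$, with the boundary ones frozen; in each triangle of $T$ one inscribes a triangle on the midpoints of its sides, oriented clockwise). Each diagonal $\gamma$ of the polygon gives a cluster variable $x_\gamma$, which is a Laurent polynomial in $x_1,\dots,x_{2n+3}$ (its $T$-expansion). $N(T,\gamma)\subset\mathbb{R}^{2n+3}$ is the Newton polytope of this Laurent polynomial, i.e. the convex hull of exponent vectors of monomials appearing with nonzero coefficient. Snake graph. Orient $\gamma\notin T$; let $\tau_{i_1},\dots,\tau_{i_d}$ be the diagonals of $T$ crossed by $\gamma$, in order, $D(\gamma)=\{\tau_{i_1},\dots,\tau_{i_d}\}$, with crossing points $p_1,\dots,p_d$, and let $p_0,p_{d+1}$ be the start and end points of $\gamma$. For $1\le k\le d-1$ the segment of $\gamma$ from $p_k$ to $p_{k+1}$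 lies in a triangle of $T$ with sides $\tau_{i_k},\tau_{i_{k+1}}$ and a third side $\tau_{[\gamma_k]}$. For a diagonal $\tau_k\in T$, $Q_{\tau_k}$ denotes the quadrilateral formed by the two triangles of $T$ containing $\tau_k$. A tile $\overline S_k$ is a square with one diagonal, with edges weighted $x_a,x_b,x_c,x_d,x_k$ via a homeomorphism $Q_{\tau_k}\to\overline S_k$ sending the side/diagonal $\tau_i$ to the edge of weight $x_i$. Embed $\overline S_{i_1}$ in the plane orientation-preservingly with the vertex corresponding to $p_0$ in the southwest corner; for $2\le k\le d$ embed $\overline S_{i_k}$ with orientation opposite to $\overline S_{i_{k-1}}$ and with its diagonal running northwest to southeast. Glue $\overline S_{i_{k+1}}$ to $\overline S_{i_k}$ along the edge weighted $x_{[\gamma_k]}$ in each (this is the north or east edge of $\overline S_{i_k}$). Removing the diagonal of every tile gives the snake graph $G_{T,\gamma}$; each edge carries a label $i$ (its weight being $x_i$). A perfect matching $M$ of $G_{T,\gamma}$ has characteristic vector in $\mathbb{R}^{2n+3}$ whose $i$-th coordinate is the number of edges of $M$ labeled $i$; $P(G_{T,\gamma})$ is the convex hull of these vectors. It is known that $x_\gamma=\sum_M w(M)/(x_{i_1}\cdots x_{i_d})$, summing over perfect matchings, where $w(M)$ is the product of the weights of the edges of $M$. An elementary subgraph of the bipartite graph $G_{T,\gamma}$ is a subgraph $H$ containing every vertex of $G_{T,\gamma}$ such that every edge of $H$ lies in some perfect matching of $H$; equivalently, a union of some set of perfect matchings of $G_{T,\gamma}$. *)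

(* Defs.v *)
From HB Require Import structures.
From mathcomp Require Import all_boot all_order all_algebra.
From mathcomp Require Import fraction mpoly.
From mathcomp Require Import boolp classical_sets functions.

Set Implicit Arguments.
Unset Strict Implicit.
Unset Printing Implicit Defensive.

Import Order.TTheory GRing.Theory Num.Theory.

Local Open Scope nat_scope.
Local Open Scope set_scope.

(** * Triangulated polygons *)

(* The vertices of the (n+3)-gon are 0, ..., n+2 in counterclockwise order; a
   segment is the set of its two endpoints. *)

Definition ccw m (a b c : 'I_m) : bool :=
  [|| a < b < c, b < c < a | c < a < b].

Definition crosses m (A B : {set 'I_m}) : bool :=
  [exists a in A, exists b in A, exists c in B, exists d in B,
     ccw a c b && ccw b d a].

Definition boundary_segment m (A : {set 'I_m}) : bool :=
  [exists a, A == [set a; ordS a]].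

Definition polygon_diagonal m (A : {set 'I_m}) : bool :=
  (#|A| == 2) && ~~ boundary_segment A.

(* A labelled collection of segments: the first n labels are meant for
   diagonals, the last n+3 for boundary segments. *)
Definition labelling (n : nat) := 'I_(n + n.+3) -> {set 'I_n.+3}.

Definition triangulation n (T : labelling n) : Prop :=
  [/\ injective T,
      forall i : 'I_n, polygon_diagonal (T (lshift n.+3 i)),
      forall j : 'I_n.+3, boundary_segment (T (rshift n j)),
      forall i j : 'I_n, ~~ crosses (T (lshift n.+3 i)) (T (lshift n.+3 j))
    & forall D : {set 'I_n.+3}, polygon_diagonal D ->
        (forall i : 'I_n, ~~ crosses D (T (lshift n.+3 i))) ->
        exists i : 'I_n, T (lshift n.+3 i) = D].

(* The vertices opposite to A in the triangles of T having A as a side: for a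
   diagonal A of T, the two vertices of the quadrilateral Q_A not on A. *)
Definition apices n (T : labelling n) (A : {set 'I_n.+3}) : {set 'I_n.+3} :=
  [set v | (v \notin A) && [forall a in A, [set v; a] \in codom T]].

Definition flip n (T : labelling n) (k : 'I_n) : labelling n :=
  fun i => if i == lshift n.+3 k then apices T (T i) else T i.

(** * Cluster variables *)

(* q i j is the number of arrows from i to j. *)
Definition quiver (N : nat) := 'I_N -> 'I_N -> nat.

(* In a triangle with vertices v, u, w in counterclockwise order, the clockwise
   inscribed triangle has an arrow from the midpoint of vu to that of vw. *)
Definition quiver_of n (T : labelling n) : quiver (n + n.+3) :=
  fun i j => #|[set p : 'I_n.+3 * 'I_n.+3 * 'I_n.+3 |
    let: (v, u, w) := p in
    [&& ccw v u w, T i == [set v; u], T j == [set v; w]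
      & [set u; w] \in codom T]]|.

(* The truncated subtraction cancels the 2-cycles created by the arrows added
   for the paths of length two through k. *)
Definition mutate_quiver N (q : quiver N) (k : 'I_N) : quiver N :=
  fun i j => if (i == k) || (j == k) then q j i
             else (q i j + q i k * q k j) - (q j i + q j k * q k i).

Definition ambient (N : nat) := {fraction {mpoly rat[N]}}.

Definition seed (N : nat) : Type := quiver N * ('I_N -> ambient N).

Definition mutate N (sd : seed N) (k : 'I_N) : seed N :=
  let: (q, x) := sd in
  (mutate_quiver q k,
   fun i => if i == k then
       ((\prod_j x j ^+ q j k + \prod_j x j ^+ q k j) / x k)%R
     else x i).

Definition initial_seed n (T : labelling n) : seed (n + n.+3) :=
  (quiver_of T, fun i => tofrac ('X_i)%R).

(* Mutations correspond to flips: z is attached to the segment D when some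
   sequence ks of flips, starting at T, puts D at position k, and the mutations
   at ks, starting at the initial seed, put z at position k. *)
Definition attached n (T : labelling n) (D : {set 'I_n.+3})
    (z : ambient (n + n.+3)) : Prop :=
  exists (ks : seq 'I_n) (k : 'I_n),
    foldl (@flip n) T ks (lshift n.+3 k) = D /\
    (foldl (fun sd j => mutate sd (lshift n.+3 j)) (initial_seed T) ks).2
      (lshift n.+3 k) = z.

(* The element attached to D is unique, so that the choice made by xget is
   immaterial. *)
Definition cluster_variable n (T : labelling n) (D : {set 'I_n.+3}) :
    ambient (n + n.+3) :=
  xget 0%R (attached T D).

(** * Polytopes *)

Section Polytopes.
Variable R : realFieldType.
Local Open Scope ring_scope.

Definition convex_hull N (S : set 'rV[R]_N) : set 'rV[R]_N :=
  (fun x => exists (m : nat) (p : 'I_m -> 'rV[R]_N) (a : 'I_m -> R),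
    [/\ forall i, S (p i), forall i, 0 <= a i, \sum_i a i = 1
      & x = \sum_i a i *: p i]).

(* The empty face and P itself are obtained with c = 0. *)
Definition face N (P : set 'rV[R]_N) : set (set 'rV[R]_N) :=
  (fun F => exists (c : 'rV[R]_N) (b : R),
    (forall x, P x -> \sum_i c 0 i * x 0 i <= b) /\
    F = (fun x => P x /\ \sum_i c 0 i * x 0 i = b)).

(* The exponent vectors of z = p / 'X_[m]; they do not depend on the choice of
   p and m. *)
Definition laurent_exponents N (z : ambient N) : set 'rV[R]_N :=
  (fun v => exists (p : {mpoly rat[N]}) (m e : 'X_{1..N}),
    [/\ z * tofrac 'X_[m] = tofrac p, e \in msupp p
      & v = \row_i ((e i)%:R - (m i)%:R)]).

Definition newton_polytope N (z : ambient N) : set 'rV[R]_N :=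
  convex_hull (laurent_exponents z).

End Polytopes.

Arguments laurent_exponents R {N} z _.
Arguments newton_polytope R {N} z _.

(** * Graphs with labelled edges *)

(* The ambient types gvert and gedge may contain more than the vertices and
   edges of the graph, which are gverts and gedges. *)
Record lgraph (L : Type) := LGraph {
  gvert : eqType;
  gedge : finType;
  gverts : pred gvert;
  gedges : {set gedge};
  gends : gedge -> seq gvert;
  glabel : gedge -> L
}.

(* M is a perfect matching of the subgraph of G with all vertices of G and edge
   set H. *)
Definition perfect_matching L (G : lgraph L) (H M : {set gedge G}) : Prop :=
  M \subset H /\
  forall v, gverts v -> #|[set e in M | v \in gends e]| = 1.

(* A subgraph of G containing all vertices of G is given by its edge set. *)
Definition elementary L (G : lgraph L) : set {set gedge G} :=
  (fun H => H \subset gedges G /\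
    forall e, e \in H -> exists2 M, perfect_matching H M & e \in M).

Arguments elementary {L} G _.

(** * Snake graphs *)

Section Snake.
Variables (n : nat) (T : labelling n) (s t : 'I_n.+3).

(* A crosses the diagonal st before B does, or A = B, when A separates s from
   the endpoints of B not on A. *)
Definition crosses_before (A B : {set 'I_n.+3}) : bool :=
  [forall b in B, (b \in A) || crosses A [set s; b]].

Definition crossed : seq {set 'I_n.+3} :=
  sort crosses_before
    [seq A <- [seq T (lshift n.+3 i) | i : 'I_n] | crosses A [set s; t]].

(* Tiles are numbered from 0. *)
Definition tile_diagonal (k : nat) : {set 'I_n.+3} := nth finset.set0 crossed k.

(* A corner of a tile is given by its coordinates in the unit square, SW being
   (false, false). A side is (true, y) if horizontal at height y, and
   (false, x) if vertical at abscissa x. *)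
Definition SW : bool * bool := (false, false).
Definition SE : bool * bool := (true, false).
Definition NE : bool * bool := (true, true).
Definition NW : bool * bool := (false, true).

Definition south : bool * bool := (true, false).
Definition north : bool * bool := (true, true).
Definition west : bool * bool := (false, false).
Definition east : bool * bool := (false, true).

Definition side_corners (e : bool * bool) : seq (bool * bool) :=
  if e.1 then [:: (false, e.2); (true, e.2)]
  else [:: (e.2, false); (e.2, true)].

(* The singleton of the polygon vertex sent to the corner c of tile k. As each
   tile is glued to the north or east side of the previous one, the triangle
   through which st reaches the diagonal is always its southwest half. The
   vertices v with ccw s v t lie to the right of st; such an endpoint of the
   diagonal is the southeast corner exactly when the embedding preserves
   orientation, that is, when k is even. *)
Definition corner (k : nat) (c : bool * bool) : {set 'I_n.+3} :=
  let A := tile_diagonal k in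
  if c == SW then [set v in apices T A | ~~ crosses A [set s; v]]
  else if c == NE then [set v in apices T A | ~~ crosses A [set t; v]]
  else if (c == SE) (+) odd k then [set v in A | ccw s v t]
  else [set v in A | ccw t v s].

Definition side_segment (k : nat) (e : bool * bool) : {set 'I_n.+3} :=
  \bigcup_(c <- side_corners e) corner k c.

(* The third side of the triangle with sides the diagonals of tiles k and
   k + 1, which share one endpoint. *)
Definition third_side (k : nat) : {set 'I_n.+3} :=
  let A := tile_diagonal k in let B := tile_diagonal k.+1 in
  (A :\: B) :|: (B :\: A).

Definition glue_north (k : nat) : bool := side_segment k north == third_side k.

(* The southwest corner of tile k in the plane: gluing makes the snake graph a
   subgraph of the square grid. *)
Fixpoint tile_position (k : nat) : nat * nat :=
  if k is j.+1 then
    let: (x, y) := tile_position j in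
    if glue_north j then (x, y.+1) else (x.+1, y)
  else (0, 0).

Definition corner_position (k : nat) (c : bool * bool) : nat * nat :=
  let: (x, y) := tile_position k in (x + c.1, y + c.2).

(* The side of tile k along which it is glued to the previous tile; this edge
   is kept as a side of the previous tile only. *)
Definition duplicate_side (k : nat) (e : bool * bool) : bool :=
  (0 < k) && (e == if glue_north k.-1 then south else west).

(* Instead of an index i, an edge carries as label the segment T i. *)
Definition snake_graph : lgraph {set 'I_n.+3} :=
  @LGraph {set 'I_n.+3} (nat * nat)%type
    ('I_(size crossed) * (bool * bool))%type
    [pred v | [exists k : 'I_(size crossed),
       v \in [seq corner_position k c | c <- [:: SW; SE; NE; NW]]]]
    [set e : 'I_(size crossed) * (bool * bool) | ~~ duplicate_side e.1 e.2]
    (fun e => [seq corner_position e.1 c | c <- side_corners e.2])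
    (fun e => side_segment e.1 e.2).

Definition matching_vector (R : realFieldType) (M : {set gedge snake_graph}) :
    'rV[R]_(n + n.+3) :=
  (\row_i #|[set e in M | glabel e == T i]|%:R)%R.

Definition matching_polytope (R : realFieldType) : set 'rV[R]_(n + n.+3) :=
  convex_hull (fun x => exists2 M : {set gedge snake_graph},
    perfect_matching (gedges snake_graph) M & x = matching_vector R M).

End Snake.

Arguments matching_polytope {n} T s t R _.

(** * Isomorphism of lattices given by their orders *)

Definition order_isomorphic X Y (A : set X) (leA : X -> X -> Prop)
    (B : set Y) (leB : Y -> Y -> Prop) : Prop :=
  exists f : X -> Y, set_bij A B f /\
    forall x y, A x -> A y -> (leA x y <-> leB (f x) (f y)).

(* Main.v *)
(** A perfect matching of the snake graph is encoded by one bit per tile, saying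
    which of the southeast and northwest corners of the tile is matched by the
    edges lying before its northeast half; gluing forbids one pair of equal
    consecutive bits. Up to complementing every other bit, these are the order
    ideals of a fence. Hence if a matching M lies in the union of matchings
    F_1, ..., F_r, the level sets of the sum of the F_i minus M are r - 1
    matchings, and a linear form maximal on all F_i is maximal on M: a face is
    determined by the union of its matchings. The labels of the glued edges and of
    the south edge of the first tile occur only once, so that the bits, and then
    the indicators of all edges, are affine functions of the characteristic
    vector; this makes every elementary subgraph the support of a face.

    Lambda lengths are realized as determinants of vectors of the plane, which
    satisfy the Ptolemy relations and so follow flips and mutations. Along the
    diagonals crossed by st these relations are the recursion for the generating
    function of the matchings, which has positive coefficients; the Newton
    polytope is therefore a translate of the matching polytope. *)

Require Import Defs.
From HB Require Import structures.
From mathcomp Require Import all_boot all_order all_algebra.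
From mathcomp Require Import fraction mpoly.
From mathcomp Require Import boolp classical_sets functions.
From mathcomp Require Import zify ring lra.

Set Implicit Arguments.
Unset Strict Implicit.
Unset Printing Implicit Defensive.

Import Order.TTheory GRing.Theory Num.Theory.

Local Open Scope nat_scope.
Local Open Scope set_scope.

(** * Faces of polytopes spanned by matchings *)

(** Distinct edges may carry the same label, so a coordinate of the characteristic vector is in
    general not the indicator of an edge. The diagonals crossed by [st] do occur several times as
    labels; the third side of the triangle between two consecutive ones neither crosses [st] nor
    ends at [s] or [t], and this is why the glued edges are those that can be read off.

    The argument on faces sees a matching only through a map [vec]. Taking for it the characteristic
    vector plus a constant [w] serves both polytopes: [w] is 0 for the matching polytope and minus
    the exponent of the denominator for the Newton polytope.

    On the cluster side positivity is used twice: it excludes cancellation in the numerator, so that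
    every matching contributes an exponent, and it shows that lambda lengths do not vanish, which
    the divisions in mutations require. As a cluster variable is defined by a choice, both a
    sequence of flips reaching [st] and the agreement of all such sequences are needed. *)

Section Faces.
Local Open Scope ring_scope.
Variables (R : realFieldType) (L : Type) (G : lgraph L) (N : nat).
Variable vec : {set gedge G} -> 'rV[R]_N.

Definition dotp (c x : 'rV[R]_N) : R := \sum_i c 0 i * x 0 i.

Lemma dotpDr c x y : dotp c (x + y) = dotp c x + dotp c y.
Proof. by rewrite -big_split; apply: eq_bigr => i _; rewrite mxE mulrDr. Qed.

Lemma dotpZr c a x : dotp c (a *: x) = a * dotp c x.
Proof. by rewrite big_distrr; apply: eq_bigr => i _; rewrite mxE mulrCA. Qed.

Lemma dotp0r c : dotp c 0 = 0.
Proof. by rewrite -[0](scale0r 0) dotpZr mul0r. Qed.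

Lemma dotp_sumr I (r : seq I) c (F : I -> 'rV[R]_N) :
  dotp c (\sum_(i <- r) F i) = \sum_(i <- r) dotp c (F i).
Proof. by elim/big_rec2: _ => [|i y x _ <-]; rewrite ?dotp0r ?dotpDr. Qed.

Lemma dotpDl c d x : dotp (c + d) x = dotp c x + dotp d x.
Proof. by rewrite -big_split; apply: eq_bigr => i _; rewrite mxE mulrDl. Qed.

Lemma dotpZl c a x : dotp (a *: c) x = a * dotp c x.
Proof. by rewrite big_distrr; apply: eq_bigr => i _; rewrite mxE -mulrA. Qed.

Lemma dotp0l x : dotp 0 x = 0.
Proof. by rewrite -[0](scale0r 0) dotpZl mul0r. Qed.

Lemma dotp_suml I (r : seq I) (P : pred I) (F : I -> 'rV[R]_N) x :
  dotp (\sum_(i <- r | P i) F i) x = \sum_(i <- r | P i) dotp (F i) x.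
Proof. by elim/big_rec2: _ => [|i y c _ <-]; rewrite ?dotp0l ?dotpDl. Qed.

Definition pm (M : {set gedge G}) : Prop := perfect_matching (gedges G) M.

Definition spanned : set 'rV[R]_N :=
  convex_hull (fun x => exists2 M, pm M & x = vec M).

Definition face_support (F : set 'rV[R]_N) : {set gedge G} :=
  \bigcup_(M : {set gedge G} | `[< pm M /\ F (vec M) >]) M.

Hypothesis pm_neq0 : forall M, pm M -> M != finset.set0.
Hypothesis pm_affine : forall e, e \in gedges G ->
  exists c b, forall M, pm M -> (e \in M)%:R = dotp c (vec M) + b.
Hypothesis pm_exchange : forall M (Fs : seq {set gedge G}), pm M -> (forall F, F \in Fs -> pm F) ->
  Fs != [::] -> (forall e, e \in M -> exists2 F, F \in Fs & e \in F) ->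
  exists Gs : seq {set gedge G}, [/\ forall F, F \in Gs -> pm F, (size Gs).+1 = size Fs
    & vec M + \sum_(F <- Gs) vec F = \sum_(F <- Fs) vec F].

Lemma spanned_vec M : pm M -> spanned (vec M).
Proof.
move=> pmM; exists 1%N, (fun=> vec M), (fun=> 1); split=> //; first by exists M.
  by rewrite big_ord1.
by rewrite big_ord1 scale1r.
Qed.

(** At a point of the face, the weighted mean of the gaps [b - dotp c (p j)], all nonnegative, is
    zero; so a vertex with nonzero weight has no gap and lies on the face. *)
Lemma face_vertices F x : face spanned F -> F x ->
  exists (m : nat) (M : 'I_m -> {set gedge G}) (a : 'I_m -> R),
    [/\ forall i, pm (M i), forall i, 0 <= a i,
        forall i, a i != 0 -> F (vec (M i)), \sum_i a i = 1
      & x = \sum_i a i *: vec (M i)].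
Proof.
move=> [c [b [cb ->]]] [[m [p [a [pP a_ge0 a1 ->]]]] xb].
have /choice[M MP] : forall i, exists M, pm M /\ p i = vec M.
  by move=> i; have [M ? ?] := pP i; exists M.
have vM i : vec (M i) = p i by case: (MP i).
exists m, M, a; split=> // [i|i ai_neq0|]; first by case: (MP i).
  split; first by apply: spanned_vec; case: (MP i).
  apply/eqP; rewrite vM eq_le; apply/andP; split.
    by rewrite -vM; apply: cb; apply: spanned_vec; case: (MP i).
  rewrite leNgt; apply/negP => lt_b.
  have : 0 < \sum_j a j * (b - dotp c (p j)).
    have le0 j : 0 <= a j * (b - dotp c (p j)).
      rewrite mulr_ge0 ?subr_ge0 // -vM.
      by apply: cb; apply: spanned_vec; case: (MP j).
    rewrite (bigD1 i) //= ltr_wpDr ?sumr_ge0 // mulr_gt0 ?subr_gt0 //.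
    by rewrite lt0r ai_neq0 a_ge0.
  under eq_bigr do rewrite mulrBr -dotpZr.
  rewrite sumrB -mulr_suml a1 mul1r -dotp_sumr.
  by rewrite -[b in b - _]xb -/(dotp _ _) subrr ltxx.
by apply: eq_bigr => i _; rewrite vM.
Qed.

Lemma face_convex F m (p : 'I_m -> 'rV[R]_N) (a : 'I_m -> R) :
    face spanned F -> \sum_i a i = 1 ->
  (forall i, a i != 0 -> F (p i)) -> spanned (\sum_i a i *: p i) ->
  F (\sum_i a i *: p i).
Proof.
move=> [c [b [cb ->]]] a1 Fp Sp; split=> //.
rewrite -/(dotp c _) dotp_sumr -[RHS]mul1r -a1 mulr_suml; apply: eq_bigr => i _.
rewrite dotpZr; have [->|/Fp[_ <-]//] := eqVneq (a i) 0.
by rewrite !mul0r.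
Qed.

Lemma face_supportP F e :
  reflect (exists M, [/\ pm M, F (vec M) & e \in M]) (e \in face_support F).
Proof.
apply: (iffP bigcupP) => [[M /asboolP[pmM FM] eM]|[M [pmM FM eM]]].
  by exists M.
by exists M => //; apply/asboolP.
Qed.

(** [Fs] lists all matchings on the face. On their sum the form takes the value [size Fs] times [b];
    the matchings in [Gs] account for at most [b] each and are one fewer, so at least [b] remains
    for [M]. *)
Lemma face_exchange F M : face spanned F -> pm M -> M \subset face_support F ->
  F (vec M).
Proof.
move=> [c [b [cb FE]]] pmM sMF.
pose Fs := [seq M <- enum {: {set gedge G}} | `[< pm M /\ F (vec M) >]].
have FsP K : K \in Fs -> pm K /\ F (vec K).
  by rewrite mem_filter => /andP[/asboolP].
(* Here [pm_neq0] matters: an empty [M] would be contained even in the support of the empty face. *)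
have Fs0 : Fs != [::].
  have /set0Pn[e eM] := pm_neq0 pmM.
  have /face_supportP[K [pmK FK _]] := fintype.subsetP sMF e eM.
  have: K \in Fs by rewrite mem_filter mem_enum andbT; apply/asboolP.
  by case: Fs {FsP}.
have [||Gs [GsP sz eq_vec]] := pm_exchange pmM _ Fs0.
- by move=> K /FsP[].
- move=> e /(fintype.subsetP sMF)/face_supportP[K [pmK FK eK]]; exists K => //.
  by rewrite mem_filter mem_enum andbT; apply/asboolP.
have le_b K : pm K -> dotp c (vec K) <= b.
  by move=> pmK; apply/cb/spanned_vec.
rewrite FE; split; first exact: spanned_vec.
apply/eqP; rewrite -/(dotp _ _) eq_le le_b //=.
have: dotp c (vec M) + dotp c (\sum_(K <- Gs) vec K) = (size Fs)%:R * b.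
  rewrite -dotpDr eq_vec dotp_sumr mulr_natl -[size Fs]subn0 -sumr_const_nat big_mkord.
  rewrite (big_nth finset.set0) big_mkord; apply: eq_bigr => i _.
  have /FsP[_] : nth finset.set0 Fs i \in Fs by exact: mem_nth.
  by rewrite FE => -[].
have : dotp c (\sum_(K <- Gs) vec K) <= (size Gs)%:R * b.
  rewrite dotp_sumr mulr_natl -[size Gs]subn0 -sumr_const_nat big_mkord.
  rewrite (big_nth finset.set0) big_mkord; apply: ler_sum => i _.
  by apply: le_b; apply: GsP; apply: mem_nth.
rewrite -sz -natr1 mulrDl mul1r; lra.
Qed.

(** From supports back to faces: a point of [F] is a combination of matchings on [F]; each of them
    is contained in the larger support, so [face_exchange] puts it on [F']. *)
Lemma face_support_sub F F' : face spanned F -> face spanned F' ->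
  (F `<=` F')%classic <-> face_support F \subset face_support F'.
Proof.
move=> fF fF'; split=> [FF'|sFF' x Fx].
  apply/fintype.subsetP => e /face_supportP[M [pmM FM eM]].
  by apply/face_supportP; exists M; split=> //; apply: FF'.
have [m [M [a [pmM a_ge0 FM a1 xE]]]] := face_vertices fF Fx.
have Sx : spanned x by case: fF Fx => c [b [_ ->]] [].
rewrite xE in Sx *; apply: face_convex Sx => // i.
move=> /FM FMi; apply: face_exchange => //; apply: fintype.subset_trans sFF'.
by apply/fintype.subsetP => e eM; apply/face_supportP; exists (M i).
Qed.

Lemma elementary_face_support F : elementary G (face_support F).
Proof.
split=> [|e /face_supportP[M [pmM FM eM]]].
  by apply/fintype.subsetP => e /face_supportP[M [[/fintype.subsetP sMG _] _ /sMG]].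
exists M => //; split; last by case: pmM.
by apply/fintype.subsetP => e' e'M; apply/face_supportP; exists M.
Qed.

(** The form [C] is, up to a constant, minus the number of edges of the matching outside [H]. Among
    matchings its bound [B] is taken exactly by those inside [H], and these cover [H] by
    elementarity. For empty [H] the bound is not taken and the face is empty. *)
Lemma face_of_elementary H : elementary G H ->
  exists2 F, face spanned F & face_support F = H.
Proof.
move=> [sHG Hel].
have /choice[c cP] : forall e, exists c, exists b, e \in gedges G ->
    forall M, pm M -> (e \in M)%:R = dotp c (vec M) + b.
  move=> e; have [/pm_affine[c [b cb]]|eG] := boolP (e \in gedges G).
    by exists c, b.
  by exists 0, 0.
have /choice[b bP] := cP.
pose C := - \sum_(e in gedges G :\: H) c e.
pose B := \sum_(e in gedges G :\: H) b e.
have CB M : pm M -> dotp C (vec M) = B - #|M :\: H|%:R.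
  move=> pmM; have -> : #|M :\: H|%:R = B + dotp (- C) (vec M).
    rewrite opprK dotp_suml -big_split /= -sum1_card natr_sum.
    under [RHS]eq_bigr => e.
      rewrite inE => /andP[_ eG]; rewrite addrC -(bP e eG M pmM); over.
    rewrite [RHS](bigID (mem M)) /= [X in _ = _ + X]big1; last first.
      by move=> e /andP[_ /negPf->].
    rewrite addr0; apply: eq_big => [e|e /setDP[-> _]//].
    rewrite !inE; case: (e \in H) => //=; case eM: (e \in M); rewrite ?andbF//.
    by rewrite (fintype.subsetP pmM.1 e eM).
  by rewrite -scaleN1r dotpZl; lra.
have CB_le M : pm M -> dotp C (vec M) <= B.
  by move=> /CB->; rewrite gerBl ler0n.
pose F x := spanned x /\ dotp C x = B.
exists F.
  exists C, B; split=> // x [m [p [a [pP a_ge0 a1 ->]]]].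
  rewrite -/(dotp _ _) dotp_sumr -[leRHS]mul1r -a1 mulr_suml ler_sum// => i _.
  by rewrite dotpZr ler_wpM2l//; have [M pmM ->] := pP i; apply: CB_le.
apply/setP => e; apply/face_supportP/idP => [[M [pmM [_ FM] eM]]|eH].
  move: FM; rewrite CB// => /eqP; rewrite subr_eq -subr_eq0 opprD addNKr.
  rewrite oppr_eq0 pnatr_eq0 cards_eq0 finset.setD_eq0 => /fintype.subsetP; exact.
have [M [sMH Mdeg] eM] := Hel e eH.
have pmM : pm M by split=> //; apply: fintype.subset_trans sMH sHG.
exists M; split=> //; split; first exact: spanned_vec.
by rewrite CB //; move: sMH; rewrite -finset.setD_eq0 => /eqP->; rewrite cards0 subr0.
Qed.

Theorem face_lattice_elementary :
  order_isomorphic (face spanned) (fun F F' => F `<=` F')%classic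
    (elementary G) (fun H H' => H \subset H').
Proof.
exists face_support; split; last exact: face_support_sub.
split=> [F _|F F' /set_mem fF /set_mem fF' eqF|H /face_of_elementary[F fF <-]].
- exact: elementary_face_support.
- by rewrite eqEsubset; split; apply/face_support_sub => //; rewrite eqF.
- by exists F.
Qed.

End Faces.

(** * Perfect matchings of snake graphs *)

Section SnakeMatchings.
Variables (n : nat) (T : labelling n) (s t : 'I_n.+3).
Notation d := (size (crossed T s t)).
Notation gn := (glue_north T s t).
Notation G := (snake_graph T s t).
Notation cpos := (corner_position T s t).

Lemma tile_positionS k : tile_position T s t k.+1 =
  ((tile_position T s t k).1 + ~~ gn k, (tile_position T s t k).2 + gn k).
Proof.
rewrite /=; case: (tile_position _ _ _ k) => x y.
by case: (gn k) => /=; rewrite !(addn0, addn1).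
Qed.

Lemma corner_positionE k c :
  cpos k c = ((tile_position T s t k).1 + c.1, (tile_position T s t k).2 + c.2).
Proof. by rewrite /corner_position; case: (tile_position _ _ _ k). Qed.

(** Each gluing raises one coordinate by one, so the coordinate sum of the southwest corner counts
    tiles. Corners of a tile differ by at most two in this sum, hence tiles at least three apart are
    disjoint. *)
Lemma tile_position_monotone k j : k <= j ->
  [/\ (tile_position T s t k).1 <= (tile_position T s t j).1,
      (tile_position T s t k).2 <= (tile_position T s t j).2
    & (tile_position T s t j).1 + (tile_position T s t j).2 =
      (tile_position T s t k).1 + (tile_position T s t k).2 + (j - k)].
Proof.
elim: j => [|j IH]; first by rewrite leqn0 => /eqP->; split; lia.
rewrite leq_eqVlt => /predU1P[->|]; first by split; lia.
rewrite ltnS => kj; have [IH1 IH2 IH3] := IH kj.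
by rewrite tile_positionS; case: (gn j); split=> /=; lia.
Qed.

(* The edges at SE_k and NW_k, split into those which already belong to the
   part of the snake graph before the northeast half of tile k, and the rest. *)
Definition inSE k : seq (nat * (bool * bool)) :=
  if (0 < k) && gn k.-1 then [:: (k.-1, north); (k.-1, east)]
  else [:: (k, south)].
Definition inNW k : seq (nat * (bool * bool)) :=
  if (0 < k) && ~~ gn k.-1 then [:: (k.-1, north); (k.-1, east)]
  else [:: (k, west)].
Definition outSE k : seq (nat * (bool * bool)) :=
  (k, east) :: (if (k.+1 < d) && ~~ gn k then [:: (k.+1, south)] else [::]).
Definition outNW k : seq (nat * (bool * bool)) :=
  (k, north) :: (if (k.+1 < d) && gn k then [:: (k.+1, west)] else [::]).

(** Tile numbers are plain naturals here, so that lists such as [outSE k] can be written without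
    proofs of [k < d]; numbers out of range give [false]. *)
Definition has_edge (M : {set gedge G}) (p : nat * (bool * bool)) : bool :=
  [exists i : 'I_d, (val i == p.1) && ((i, p.2) \in M)].

Lemma has_edge_ord M (i : 'I_d) e : has_edge M (val i, e) = ((i, e) \in M).
Proof.
apply/existsP/idP => [[j /andP[/eqP/val_inj->]]//|iM].
by exists i; rewrite eqxx.
Qed.

Lemma degreeE (M : {set gedge G}) v l : M \subset gedges G -> uniq l ->
  (forall e, e \in gedges G -> (v \in gends e) = ((val e.1, e.2) \in l)) ->
  #|[set e in M | v \in gends e]| = count (has_edge M) l.
Proof.
move=> /fintype.subsetP sMG ul lP; rewrite cardE -size_filter.
rewrite -(size_map (fun e : gedge G => (val e.1, e.2))).
apply: perm_size; apply: uniq_perm; rewrite ?filter_uniq //.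
  rewrite map_inj_in_uniq ?enum_uniq // => -[i e] [j e'] _ _ /= [/val_inj-> ->].
  by [].
move=> [k e]; rewrite mem_filter; apply/mapP/andP.
  move=> [[i e']]; rewrite mem_enum inE => /andP[ieM vie] [-> ->].
  by rewrite has_edge_ord ieM -(lP (i, e')) // sMG.
move=> [/existsP[i /andP[/= /eqP<- ieM]] iel]; exists (i, e) => //.
by rewrite mem_enum inE ieM lP // sMG.
Qed.

Lemma mem_gends v (i : 'I_d) e : (v \in gends (l := G) (i, e)) =
  (v == cpos i (head SW (side_corners e))) || (v == cpos i (last SW (side_corners e))).
Proof. by rewrite /= /side_corners; case: e => -[] e /=; rewrite !inE. Qed.

Lemma cpos_eq k c c' : (cpos k c == cpos k c') = (c == c').
Proof.
rewrite !corner_positionE; case: c c' => [[] []] [[] []];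
  by rewrite !xpair_eqE /=; lia.
Qed.

Lemma cpos_eqS k c c' : (cpos k c == cpos k.+1 c') =
  if gn k then [&& c.2, ~~ c'.2 & c.1 == c'.1] else [&& c.1, ~~ c'.1 & c.2 == c'.2].
Proof.
rewrite !corner_positionE tile_positionS /=; case: (gn k);
  by case: c c' => [[] []] [[] []]; rewrite !xpair_eqE /=; lia.
Qed.

(** Tiles two apart touch only where the snake turns, in one corner. *)
Lemma cpos_eqSS k c c' : (cpos k c == cpos k.+2 c') =
  [&& gn k != gn k.+1, c == NE & c' == SW].
Proof.
rewrite !corner_positionE !tile_positionS /=; case: (gn k); case: (gn k.+1);
  by case: c c' => [[] []] [[] []]; rewrite !xpair_eqE /=; lia.
Qed.

Lemma cpos_eq_far k j c c' : k.+2 < j -> (cpos k c == cpos j c') = false.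
Proof.
move=> kj; have [|h1 h2 h3] := @tile_position_monotone k j; first lia.
apply/eqP; rewrite !corner_positionE => -[].
by case: c c' => [[] []] [[] []] /=; lia.
Qed.

(** Only tiles at distance at most two can share a corner, so incidence reduces to five explicit
    relative positions. *)
Lemma near_cases (P : nat -> nat -> Prop) :
  (forall k, P k k) -> (forall k, P k k.+1) -> (forall k, P k k.+2) ->
  (forall k, P k.+1 k) -> (forall k, P k.+2 k) ->
  (forall k j, k.+2 < j \/ j.+2 < k -> P k j) -> forall k j, P k j.
Proof.
move=> P0 P1 P2 P1' P2' Pfar k j.
have [->//|jk] := eqVneq j k; have [->//|jk1] := eqVneq j k.+1.
have [->//|jk2] := eqVneq j k.+2; have [->//|kj1] := eqVneq k j.+1.
by have [->//|kj2] := eqVneq k j.+2; apply: Pfar; lia.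
Qed.

Let cposE := (cpos_eq, cpos_eqS, cpos_eqSS,
  (fun k c c' => etrans (eq_sym (cpos k.+1 c) (cpos k c')) (cpos_eqS k c' c)),
  (fun k c c' => etrans (eq_sym (cpos k.+2 c) (cpos k c')) (cpos_eqSS k c' c))).

Lemma cpos_eq_far' k j c c' :
  k.+2 < j \/ j.+2 < k -> (cpos k c == cpos j c') = false.
Proof. by case=> kj; [|rewrite eq_sym]; apply: cpos_eq_far. Qed.

Ltac incidence := repeat (case: ifP => //= ?); rewrite ?inE ?xpair_eqE /=; lia.

Lemma SE_edges k (e : gedge G) : k < d -> e \in gedges G ->
  (cpos k SE \in gends e) = ((val e.1, e.2) \in inSE k ++ outSE k).
Proof.
case: e => i e kd; rewrite inE /= mem_gends /inSE /outSE /duplicate_side.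
case: i => /= i id; rewrite ?mem_cat.
elim/near_cases: k / i kd id => [k|k|k|k|k|k j far] kd id;
  [rewrite !cposE ..|rewrite !cpos_eq_far' //=]; case: e => -[] []; incidence.
Qed.

Lemma NW_edges k (e : gedge G) : k < d -> e \in gedges G ->
  (cpos k NW \in gends e) = ((val e.1, e.2) \in inNW k ++ outNW k).
Proof.
case: e => i e kd; rewrite inE /= mem_gends /inNW /outNW /duplicate_side.
case: i => /= i id; rewrite ?mem_cat.
elim/near_cases: k / i kd id => [k|k|k|k|k|k j far] kd id;
  [rewrite !cposE ..|rewrite !cpos_eq_far' //=]; case: e => -[] []; incidence.
Qed.

Lemma SW0_edges (e : gedge G) : e \in gedges G ->
  (cpos 0 SW \in gends e) = ((val e.1, e.2) \in [:: (0, south); (0, west)]).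
Proof.
case: e => i e; rewrite inE /= mem_gends /duplicate_side.
case: i => /= -[|[|[|i]]] id;
  [rewrite !cposE ..|rewrite !cpos_eq_far //=]; case: e => -[] []; incidence.
Qed.

Lemma NE_last_edges k (e : gedge G) : k.+1 = d -> e \in gedges G ->
  (cpos k NE \in gends e) = ((val e.1, e.2) \in [:: (k, north); (k, east)]).
Proof.
case: e => i e kd; rewrite inE /= mem_gends /duplicate_side.
case: i => /= i id; rewrite ?mem_cat.
elim/near_cases: k / i kd id => [k|k|k|k|k|k j far] kd id;
  [rewrite !cposE ..|rewrite !cpos_eq_far' //=]; case: e => -[] []; incidence.
Qed.
End SnakeMatchings.

(** * Matchings as sequences of bits *)

Section SnakeStates.
Variables (n : nat) (T : labelling n) (s t : 'I_n.+3).
Notation d := (size (crossed T s t)).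
Notation gn := (glue_north T s t).
Notation G := (snake_graph T s t).
Notation cpos := (corner_position T s t).
Notation inSE := (inSE T s t).
Notation inNW := (inNW T s t).
Notation outSE := (outSE T s t).
Notation outNW := (outNW T s t).

(* A perfect matching is encoded by g: the edges of the snake graph before the
   northeast half of tile k match exactly one of SE_k and NW_k, namely SE_k
   when g k holds. *)
Definition allowed (g : nat -> bool) : Prop := forall k, k.+1 < d ->
  if gn k then g k || g k.+1 else ~~ (g k && g k.+1).

(** When [g k] holds, NW_k is left to the edges of [outNW k]: the north side, unless the next tile
    is glued there and its west side, present when [g k.+1] fails, does the job. The same holds for
    SE_k and the east side when [g k] fails. Values on duplicate sides have no meaning and are
    discarded by [gedges]. *)
Definition in_state (g : nat -> bool) (p : nat * (bool * bool)) : bool :=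
  if p.2 == south then g p.1 else if p.2 == west then ~~ g p.1
  else if p.2 == north then g p.1 && ((p.1.+1 < d) && gn p.1 ==> g p.1.+1)
  else ~~ g p.1 && ((p.1.+1 < d) && ~~ gn p.1 ==> ~~ g p.1.+1).

Definition state_matching g : {set gedge G} :=
  [set e in gedges G | in_state g (val e.1, e.2)].

Lemma has_edge_state g k e : has_edge (state_matching g) (k, e) =
  [&& k < d, ~~ duplicate_side T s t k e & in_state g (k, e)].
Proof.
have [kd|kd] := ltnP k d.
  by rewrite (has_edge_ord _ (Ordinal kd)) !inE.
by apply/existsP => -[i /andP[/eqP /= ik _]]; have := ltn_ord i; lia.
Qed.

(** A southwest corner other than the first, or a northeast corner other than the last, is a
    southeast or northwest corner of the neighbouring tile. *)
Lemma vertexP v : gverts (l := G) v ->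
  exists k, k < d /\ [\/ v = cpos k SE, v = cpos k NW, k = 0 /\ v = cpos k SW
    | k.+1 = d /\ v = cpos k NE].
Proof.
move=> /existsP[[k kd]] /=; rewrite !inE => /or4P[] /eqP->.
- case: k kd => [|k] kd; first by exists 0; split=> //; constructor 3.
  exists k; split; first lia.
  case gnk: (gn k); [constructor 2|constructor 1]; apply/esym/eqP;
    by rewrite cpos_eqS gnk.
- by exists k; split=> //; constructor 1.
- have [k1d|k1d] := ltnP k.+1 d; last by exists k; split=> //; constructor 4; split=> //; lia.
  exists k.+1; split=> //.
  case gnk: (gn k); [constructor 1|constructor 2]; apply/eqP;
    by rewrite cpos_eqS gnk.
- by exists k; split=> //; constructor 2.
Qed.

Lemma duplicate_north k : duplicate_side T s t k north = false.
Proof. by rewrite /duplicate_side; case: (gn _); rewrite andbF. Qed.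

Lemma duplicate_east k : duplicate_side T s t k east = false.
Proof. by rewrite /duplicate_side; case: (gn _); rewrite andbF. Qed.

Lemma count_in_state g k : allowed g -> k < d ->
  (count (has_edge (state_matching g)) (inSE k) = g k) *
  (count (has_edge (state_matching g)) (inNW k) = ~~ g k) *
  (count (has_edge (state_matching g)) (outSE k) = ~~ g k) *
  (count (has_edge (state_matching g)) (outNW k) = g k).
Proof.
move=> ag kd; have := ag k; have := ag k.-1.
rewrite /inSE /inNW /outSE /outNW; case: k kd => [|k] kd /=.
  move=> _; have [D /(_ isT)|/leq_gtF D _] := ltnP 1 d;
    case A: (gn 0); rewrite ?A /= !has_edge_state
       /duplicate_side /in_state /= ?D ?A kd;
    by case: (g 0); case: (g 1).
move=> /(_ kd); have kd' := ltnW kd.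
have [D + /(_ isT)|/leq_gtF D + _] := ltnP k.+2 d;
  case A: (gn k); case B: (gn k.+1); rewrite ?A ?B ?D /= !has_edge_state
   ?(duplicate_north, duplicate_east) /duplicate_side /in_state /= ?A ?B ?D ?kd ?kd' /=;
  by case: (g k); case: (g k.+1); case: (g k.+2).
Qed.

Lemma pm_state_matching g : allowed g -> pm (state_matching g).
Proof.
move=> ag; split; first by apply/fintype.subsetP => e; rewrite inE => /andP[].
have sG : state_matching g \subset gedges G.
  by apply/fintype.subsetP => e; rewrite inE => /andP[].
move=> v /vertexP[k [kd]] [->|->|[k0 ->]|[kl ->]].
- rewrite (degreeE sG _ (fun e => @SE_edges _ _ _ _ k e kd)).
    by rewrite count_cat !count_in_state //; case: (g k).
  by rewrite /inSE /outSE; repeat case: ifP => ?; rewrite /= !inE !xpair_eqE; lia.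
- rewrite (degreeE sG _ (fun e => @NW_edges _ _ _ _ k e kd)).
    by rewrite count_cat !count_in_state //; case: (g k).
  by rewrite /inNW /outNW; repeat case: ifP => ?; rewrite /= !inE !xpair_eqE; lia.
- subst k; rewrite (degreeE sG _ (@SW0_edges _ _ _ _)) //=.
  have := count_in_state ag kd; rewrite /inSE /inNW /= => -[[[e1 e2] _] _].
  by case: (g 0) e1 e2 => /=; lia.
- rewrite (degreeE sG _ (fun e => @NE_last_edges _ _ _ _ k e kl)).
    have := count_in_state ag kd; rewrite /outSE /outNW kl ltnn /= => -[[_ e1] e2].
    by case: (g k) e1 e2 => /=; lia.
  by rewrite /= !inE !xpair_eqE; lia.
Qed.

(** The bit of tile [k] records whether [inSE k] meets [M]; the degree conditions at SE_k and NW_k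
    then determine all edges. *)
Lemma state_of_pm M : pm (G := G) M -> exists2 g, allowed g & M = state_matching g.
Proof.
move=> [sMG Mdeg]; pose c := count (has_edge M).
have vP k x : k < d -> gverts (l := G) (cpos k x).
  move=> kd; apply/existsP; exists (Ordinal kd) => /=.
  by case: x => [[] []]; rewrite !inE eqxx ?orbT.
have SEk k : k < d -> c (inSE k) + c (outSE k) = 1.
  move=> kd; rewrite -count_cat -(degreeE (v := cpos k SE) sMG).
  - by apply/Mdeg/vP.
  - by rewrite /inSE /outSE; repeat case: ifP => ?; rewrite /= !inE !xpair_eqE; lia.
  - by move=> e; apply: SE_edges.
have NWk k : k < d -> c (inNW k) + c (outNW k) = 1.
  move=> kd; rewrite -count_cat -(degreeE (v := cpos k NW) sMG).
  - by apply/Mdeg/vP.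
  - by rewrite /inNW /outNW; repeat case: ifP => ?; rewrite /= !inE !xpair_eqE; lia.
  - by move=> e; apply: NW_edges.
(* Induction works because [inSE k.+1] and [inNW k.+1] together consist of the same edges as
   [outSE k] and [outNW k], whose total count is 2 minus that of [inSE k] and [inNW k]. It starts at
   the southwest corner of the first tile, which meets only its south and west sides. *)
have inv k : k < d -> c (inSE k) + c (inNW k) = 1.
  elim: k => [|k IH] kd.
    rewrite -count_cat -(degreeE (v := cpos 0 SW) sMG) //.
    - by apply/Mdeg/vP.
    - exact: SW0_edges.
  have kd' := ltnW kd; have := IH kd'; have := SEk k kd'; have := NWk k kd'.
  rewrite /c /inSE /inNW /outSE /outNW kd /=.
  by case: (gn k); repeat case: ifP => ? /=; lia.
have inNWS k : gn k -> c (inNW k.+1) = has_edge M (k.+1, west).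
  by rewrite /c /inNW => ->; rewrite /= addn0.
have inSES k : ~~ gn k -> c (inSE k.+1) = has_edge M (k.+1, south).
  by rewrite /c /inSE => /negPf->; rewrite /= addn0.
have cSE k : c (outSE k) = has_edge M (k, east) +
    (if (k.+1 < d) && ~~ gn k then c (inSE k.+1) else 0).
  by rewrite {1}/c /outSE; case: ifP => //= /andP[_ /inSES->]; rewrite addn0.
have cNW k : c (outNW k) = has_edge M (k, north) +
    (if (k.+1 < d) && gn k then c (inNW k.+1) else 0).
  by rewrite {1}/c /outNW; case: ifP => //= /andP[_ /inNWS->]; rewrite addn0.
exists (fun k => 0 < c (inSE k)).
  move=> k kd; have kd' := ltnW kd; have := inv k kd'; have := inv k.+1 kd.
  have := SEk k kd'; have := NWk k kd'; rewrite cSE cNW kd /=.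
  by case: (gn k) => /=; lia.
apply/setP => -[[k kd] e]; rewrite !inE /=.
have [dup|ndup] := boolP (duplicate_side _ _ _ _ _).
  by apply/idP => /(fintype.subsetP sMG); rewrite inE /= dup.
rewrite -has_edge_ord /in_state /=.
have invk := inv k kd; have invk1 := inv k.+1.
have := SEk k kd; have := NWk k kd; rewrite cSE cNW.
case: e ndup => -[] [] /= ndup; rewrite -/north -/south -/west -/east.
- by case: (k.+1 < d) invk1 => [/(_ isT)|_] /=; case: (gn k) => /=; lia.
- move=> _ _; have : c (inSE k) = has_edge M (k, south); last by lia.
  rewrite /c /inSE; case: ifP ndup => [/andP[k0 gk]|_ _] /=; last by rewrite addn0.
  by rewrite /duplicate_side k0 gk.
- by case: (k.+1 < d) invk1 => [/(_ isT)|_] /=; case: (gn k) => /=; lia.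
- move=> _ _; have : c (inNW k) = has_edge M (k, west); last by lia.
  rewrite /c /inNW; case: ifP ndup => [/andP[k0 /negPf gk]|_ _] /=; last by rewrite addn0.
  by rewrite /duplicate_side k0 gk.
Qed.

End SnakeStates.

(** * Exchange of matchings *)

Section SnakeExchange.
Variables (n : nat) (T : labelling n) (s t : 'I_n.+3).
Notation d := (size (crossed T s t)).
Notation gn := (glue_north T s t).
Notation G := (snake_graph T s t).
Notation allowed := (allowed T s t).
Notation in_state := (in_state T s t).
Notation state_matching := (state_matching T s t).

Lemma mem_state_matching g (e : gedge G) : e \in gedges G ->
  (e \in state_matching g) = in_state g (val e.1, e.2).
Proof. by move=> eG; rewrite inE eG. Qed.

(** Since one pair of consecutive bits is forbidden, conjunctions of bits become affine: if tile [k]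
    is glued on its north side, [g k && g k.+1] equals [g k + g k.+1 - 1]. So the number of states
    containing an edge depends only on the number of states having each bit. *)
Lemma count_state (I : eqType) (r : seq I) (f : I -> nat -> bool) k :
  (forall i, i \in r -> allowed (f i)) ->
  [/\ count (fun i => in_state (f i) (k, south)) r = count (f^~ k) r,
      count (fun i => in_state (f i) (k, west)) r + count (f^~ k) r = size r,
      count (fun i => in_state (f i) (k, north)) r +
        (if (k.+1 < d) && gn k then size r else 0) =
        count (f^~ k) r + (if (k.+1 < d) && gn k then count (f^~ k.+1) r else 0)
    & count (fun i => in_state (f i) (k, east)) r + count (f^~ k) r +
        (if (k.+1 < d) && ~~ gn k then count (f^~ k.+1) r else 0) = size r].
Proof.
elim: r => [|i r IH] rP; first by split=> //=; rewrite ?if_same.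
have {}/IH[IH1 IH2 IH3 IH4] : forall i, i \in r -> allowed (f i).
  by move=> j jr; apply: rP; rewrite inE jr orbT.
have := rP i (mem_head i r) k; rewrite /=.
have -> : in_state (f i) (k, south) = f i k by [].
have -> : in_state (f i) (k, west) = ~~ f i k by [].
have -> : in_state (f i) (k, north) =
  f i k && ((k.+1 < d) && gn k ==> f i k.+1) by [].
have -> : in_state (f i) (k, east) =
  ~~ f i k && ((k.+1 < d) && ~~ gn k ==> ~~ f i k.+1) by [].
case: (k.+1 < d) IH3 IH4 => /= IH3 IH4; last first.
  by move=> _; case: (f i k) => /=; split; lia.
move=> /(_ isT); case: (gn k) IH3 IH4 => /= IH3 IH4;
  by case: (f i k); case: (f i k.+1) => //= _; split; lia.
Qed.

Lemma count_state_eq (I J : eqType) (r : seq I) (r' : seq J) f f' (e : gedge G) :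
  (forall i, i \in r -> allowed (f i)) -> (forall i, i \in r' -> allowed (f' i)) ->
  size r = size r' -> (forall k, k < d -> count (f^~ k) r = count (f'^~ k) r') ->
  count (fun i => e \in state_matching (f i)) r =
  count (fun i => e \in state_matching (f' i)) r'.
Proof.
move=> fP f'P sz eqc; have [eG|eG] := boolP (e \in gedges G); last first.
  by rewrite !(@eq_count _ _ pred0) ?count_pred0 // => i; rewrite inE (negPf eG).
under eq_count => i do rewrite mem_state_matching //.
under [RHS]eq_count => i do rewrite mem_state_matching //.
case: e {eG} => -[k kd] e /=; have := eqc k kd; have := eqc k.+1.
have := count_state k fP; have := count_state k f'P; rewrite sz.
case: e => -[] []; rewrite -/north -/south -/east -/west.
all: case: (k.+1 < d); case: (gn k) => /= -[? ? ? ?] [? ? ? ?]; try move=> /(_ isT); lia.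
Qed.

Lemma count_leq_iota c r : c <= r -> count (fun j => j <= c) (iota 1 r) = c.
Proof.
move=> cr; rewrite -(subnKC cr) iotaD count_cat.
rewrite (@eq_in_count _ _ xpredT) ?count_predT ?size_iota; last first.
  by move=> j; rewrite mem_iota; lia.
rewrite (@eq_in_count _ _ pred0) ?count_pred0 ?addn0 // => j.
by rewrite mem_iota /=; lia.
Qed.

Lemma count_geq_iota c r : c <= r -> count (fun j => r.+1 - j <= c) (iota 1 r) = c.
Proof.
move=> cr; rewrite -{2}(subnK cr) iotaD count_cat.
rewrite (@eq_in_count _ _ pred0) ?count_pred0; last first.
  by move=> j; rewrite mem_iota /=; lia.
rewrite (@eq_in_count _ _ xpredT) ?count_predT ?size_iota // => j.
by rewrite mem_iota; lia.
Qed.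

Lemma snake_exchange M (Fs : seq {set gedge G}) :
  pm M -> (forall F, F \in Fs -> pm F) -> Fs != [::] ->
  (forall e, e \in M -> exists2 F, F \in Fs & e \in F) ->
  exists Gs : seq {set gedge G}, [/\ forall F, F \in Gs -> pm F,
    (size Gs).+1 = size Fs
  & forall e, (e \in M) + count (fun F : {set gedge G} => e \in F) Gs =
      count (fun F : {set gedge G} => e \in F) Fs].
Proof.
move=> pmM FsP Fs0 cov.
have /choice[st stP] : forall F, exists g, pm F -> allowed g /\ F = state_matching g.
  move=> F; have [/state_of_pm[g ag eF]|nF] := pselect (pm F).
    by exists g.
  by exists (fun=> false).
have aM := (stP M pmM).1; have eM := (stP M pmM).2; set g := st M in aM eM.
have aF F : F \in Fs -> allowed (st F) by move=> /FsP/stP[].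
have eF F : F \in Fs -> F = state_matching (st F) by move=> /FsP/stP[].
pose r := (size Fs).-1; have szF : size Fs = r.+1.
  by rewrite /r; case: (Fs) Fs0.
pose u k := count (fun F => st F k) Fs.
have cov_has l : has (has_edge M) l -> exists2 F, F \in Fs & has (has_edge F) l.
  move=> /hasP[p pl /existsP[i /andP[/eqP ip /cov[F FFs iF]]]].
  by exists F => //; apply/hasP; exists p => //; apply/existsP; exists i; rewrite ip eqxx.
have u_gt0 k : k < d -> g k -> 0 < u k.
  move=> kd gk; have := (count_in_state aM kd).1.1.1; rewrite -eM gk => cM.
  have /cov_has[F FFs] : has (has_edge M) (inSE T s t k) by rewrite has_count cM.
  rewrite (eF F FFs) has_count (count_in_state (aF F FFs) kd) lt0b => FF.
  by rewrite -has_count; apply/hasP; exists F.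
have u_ltr k : k < d -> ~~ g k -> u k <= r.
  move=> kd gk; have := (count_in_state aM kd).1.1.2; rewrite -eM gk => cM.
  have /cov_has[F FFs] : has (has_edge M) (inNW T s t k) by rewrite has_count cM.
  rewrite (eF F FFs) has_count (count_in_state (aF F FFs) kd) lt0b => FF.
  have := count_predC (fun F => st F k) Fs; rewrite -/(u k) szF.
  suff : 0 < count (predC (fun F => st F k)) Fs by lia.
  by rewrite -has_count; apply/hasP; exists F.
have u_le k : u k <= r.+1 by rewrite -szF count_size.
have cov_edge (e : gedge G) : e \in gedges G -> in_state g (val e.1, e.2) ->
    has (fun F => in_state (st F) (val e.1, e.2)) Fs.
  move=> eG; rewrite -mem_state_matching // -eM => /cov[F FFs FM].
  by apply/hasP; exists F => //; rewrite -mem_state_matching // -eF.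
pose c k := u k - g k.
have c_le k : k < d -> c k <= r.
  by move=> kd; have := u_ltr k kd; have := u_le k; rewrite /c; case: (g k) => /=; lia.
have cD k : k < d -> g k + c k = u k.
  by move=> kd; have := u_gt0 k kd; rewrite /c; case: (g k) => /=; lia.
(* If the two bits of [M] differ, the bound follows from the same condition on the members of [Fs].
   If they agree, one unit is missing: [M] then contains the glued edge, which lies in some member
   of [Fs], and this member has the same two bits. *)
have c_adj k : k.+1 < d -> if gn k then r <= c k + c k.+1 else c k + c k.+1 <= r.
  move=> kd; have kd' := ltnW kd; have := cD k kd'; have := cD k.+1 kd.
  have := count_predUI (fun F => st F k) (fun F => st F k.+1) Fs.
  rewrite -/(u k) -/(u k.+1); have := aM k kd.
  have := cov_edge (Ordinal kd', north); have := cov_edge (Ordinal kd', east).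
  rewrite !inE duplicate_north duplicate_east => /(_ isT) + /(_ isT).
  rewrite /in_state /= kd /=; case gnk: (gn k) => /=.
    move=> _ covN agk.
    have -> : count (predU (fun F => st F k) (fun F => st F k.+1)) Fs = r.+1.
      rewrite -szF; apply/eqP; rewrite -all_count; apply/allP => F /aF/(_ k kd) /=.
      by rewrite gnk.
    have := has_count (predI (fun F => st F k) (fun F => st F k.+1)) Fs.
    rewrite (eq_has (a2 := fun F => st F k && st F k.+1)) //.
    by move: covN agk; case: (g k); case: (g k.+1) => //= covN _;
      try rewrite (covN isT); lia.
  rewrite andbT => covE _ agk.
  have -> : count (predI (fun F => st F k) (fun F => st F k.+1)) Fs = 0.
    rewrite (@eq_in_count _ _ pred0) ?count_pred0 // => F /aF/(_ k kd) /=.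
    by rewrite gnk => /negPf.
  have := count_predC (predU (fun F => st F k) (fun F => st F k.+1)) Fs.
  have := has_count (predC (predU (fun F => st F k) (fun F => st F k.+1))) Fs.
  rewrite (eq_has (a2 := fun F => ~~ st F k && ~~ st F k.+1)); last first.
    by move=> F /=; rewrite negb_or.
  rewrite szF.
  by move: covE agk; case: (g k); case: (g k.+1) => //= covE _;
    try rewrite (covE isT); lia.
(* The h j are the level sets of c; taking complements in every other tile turns
   the conditions of [allowed] into monotonicity conditions. *)
pose h j k := if odd k then r.+1 - j <= c k else j <= c k.
have ah j : j \in iota 1 r -> allowed (h j).
  rewrite mem_iota => jr k kd; have := c_adj k kd; rewrite /h /=.
  by case: (gn k) => /=; case: (odd k) => /=; lia.
exists [seq state_matching (h j) | j <- iota 1 r]; split.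
- by move=> F /mapP[j /ah ahj ->]; apply: pm_state_matching.
- by rewrite size_map size_iota.
move=> e; rewrite count_map.
rewrite (eq_in_count (a2 := fun F => e \in state_matching (st F))); last first.
  by move=> F /eF{1}->.
(* Index 0 stands for [M], so that [count_state_eq] compares the [r.+1] states [f 0], ..., [f r]
   with those of [Fs]. *)
pose f j := if j is 0 then g else h j.
have := @count_state_eq _ _ (0 :: iota 1 r) Fs f st e; rewrite /= -/g -eM.
rewrite (eq_in_count (a2 := preim (fun j => state_matching (h j))
  (fun F : {set gedge G} => e \in F))).
  apply=> //; first by move=> [|j]; rewrite inE //= => /ah.
    by rewrite size_iota szF.
  move=> k kd; rewrite -/(u k) -cD //; congr (_ + _).
  rewrite (eq_in_count (a2 := h^~ k)) => [|[|j]]; rewrite ?mem_iota //.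
  by rewrite /h; case: (odd k); [apply: count_geq_iota|apply: count_leq_iota]; apply: c_le.
by move=> [|j]; rewrite ?mem_iota.
Qed.

End SnakeExchange.

(** * Edge indicators as affine functions *)

Section SnakeFaces.
Variables (n : nat) (T : labelling n) (s t : 'I_n.+3) (R : realFieldType).
Notation d := (size (crossed T s t)).
Notation gn := (glue_north T s t).
Notation G := (snake_graph T s t).
Notation allowed := (allowed T s t).
Notation in_state := (in_state T s t).
Notation state_matching := (state_matching T s t).
Local Open Scope ring_scope.

Definition unique_label (k : nat) (e : bool * bool) : Prop :=
  exists i, forall e', e' \in gedges G ->
    (glabel e' == T i) = ((val e'.1, e'.2) == (k, e)).

Variable w : 'rV[R]_(n + n.+3).
Let vec (M : {set gedge G}) := matching_vector R M + w.

Hypothesis d_gt0 : (0 < d)%N.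
Hypothesis unique_first : unique_label 0 south.
Hypothesis unique_glue : forall k, (k.+1 < d)%N ->
  unique_label k (if gn k then north else east).

Definition affine_state (f : (nat -> bool) -> R) : Prop :=
  exists c b, forall g, allowed g -> f g = dotp c (vec (state_matching g)) + b.

Lemma affine_stateB f f' : affine_state f -> affine_state f' ->
  affine_state (fun g => f g - f' g).
Proof.
move=> [c [b cb]] [c' [b' cb']]; exists (c - c'), (b - b') => g ag.
by rewrite cb // cb' // dotpDl -[- c']scaleN1r dotpZl; ring.
Qed.

Lemma affine_state_cst a : affine_state (fun=> a).
Proof. by exists 0, a => g _; rewrite dotp0l add0r. Qed.

Lemma eq_affine_state f f' : (forall g, allowed g -> f g = f' g) ->
  affine_state f -> affine_state f'.
Proof. by move=> ff' [c [b cb]]; exists c, b => g ag; rewrite -ff' ?cb. Qed.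

(** The coordinate of this label counts a single edge, up to the shift [w 0 i]. *)
Lemma affine_unique_label k e (kd : (k < d)%N) :
  ~~ duplicate_side T s t k e -> unique_label k e ->
  affine_state (fun g => (in_state g (k, e))%:R).
Proof.
move=> ndup [i iP]; exists (delta_mx 0 i), (- w 0 i) => g _.
rewrite /dotp (bigD1 i) //= big1 => [|j ji]; last by rewrite mxE (negPf ji) andbF mul0r.
rewrite !mxE !eqxx mul1r addr0 addrK.
congr (_%:R); transitivity (#|[set e' in state_matching g | e' == (Ordinal kd, e)]|).
  have [ge|ge] := boolP (in_state g (k, e)).
    rewrite -[RHS]/(#|_| : nat) (_ : finset _ = [set (Ordinal kd, e)]) ?cards1 //.
    apply/setP => e'; rewrite !inE; apply/andP/eqP => [[_ /eqP//]|->].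
    by rewrite /= ndup ge eqxx.
  rewrite (_ : finset _ = finset.set0) ?cards0 //.
  apply/setP => e'; rewrite !inE; apply/negP => /andP[/andP[_ +] /eqP e'E].
  by rewrite e'E /= (negPf ge).
apply: eq_card => e'; rewrite !inE; have [nd|//] := boolP (~~ _).
by rewrite iP ?inE // (_ : (e' == _) = ((val e'.1, e'.2) == (k, e))).
Qed.

(** The bit [g 0] is the south edge of the first tile. The indicator of the glued edge of tile [k]
    is, one pair of bits being forbidden, an affine function of [g k] and [g k.+1]; solving it for
    [g k.+1] propagates affineness. *)
Lemma affine_state_bit k : (k < d)%N -> affine_state (fun g => (g k)%:R).
Proof.
elim: k => [|k IH] kd; first exact: affine_unique_label unique_first.
have kd' := ltnW kd; have Ak := IH kd'; have Agl := unique_glue kd.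
apply: (eq_affine_state (f := fun g =>
  (if gn k then (in_state g (k, north))%:R + 1 - (g k)%:R
   else 1 - (g k)%:R - (in_state g (k, east))%:R))).
  move=> g /(_ k kd); rewrite /in_state /= kd.
  by case: (gn k) => /=; case: (g k); case: (g k.+1) => //= _; ring.
case: (gn k) Agl => Agl; last first.
  apply: affine_stateB; last by apply: affine_unique_label => //; rewrite duplicate_east.
  by apply: affine_stateB => //; apply: affine_state_cst.
apply: affine_stateB => //.
apply: (eq_affine_state (f := fun g => (in_state g (k, north))%:R - (-1))).
  by move=> g _; rewrite opprK.
apply: affine_stateB; last exact: affine_state_cst.
by apply: affine_unique_label => //; rewrite duplicate_north.
Qed.

Lemma affine_state_edge k e : (k < d)%N ->
  affine_state (fun g => (in_state g (k, e))%:R).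
Proof.
move=> kd; have Ak := affine_state_bit kd.
have ANk : affine_state (fun g => (~~ g k)%:R).
  apply: (eq_affine_state (f := fun g => 1 - (g k)%:R)).
    by move=> g _; case: (g k); rewrite ?subrr ?subr0.
  by apply: affine_stateB => //; apply: affine_state_cst.
case: e => -[] []; rewrite /in_state //=.
- case: (ltnP k.+1 d) => kd1; last by apply: eq_affine_state Ak => g _; rewrite andbT.
  have Ak1 := affine_state_bit kd1; case gnk: (gn k) => /=; last first.
    by apply: eq_affine_state Ak => g _; rewrite andbT.
  apply: (eq_affine_state (f := fun g => (g k)%:R - (1 - (g k.+1)%:R))).
    move=> g /(_ k kd1); rewrite gnk.
    by case: (g k); case: (g k.+1) => //= _; ring.
  by do 2?apply: affine_stateB => //; apply: affine_state_cst.
- case: (ltnP k.+1 d) => kd1; last by apply: eq_affine_state ANk => g _; rewrite andbT.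
  have Ak1 := affine_state_bit kd1; case gnk: (gn k) => /=.
    by apply: eq_affine_state ANk => g _; rewrite andbT.
  apply: (eq_affine_state (f := fun g => 1 - (g k)%:R - (g k.+1)%:R)).
    move=> g /(_ k kd1); rewrite gnk.
    by case: (g k); case: (g k.+1) => //= _; ring.
  by do 2?apply: affine_stateB => //; apply: affine_state_cst.
Qed.

(** The sum depends only on how often each edge is used and on the number of matchings; hence
    [snake_exchange], a statement about edges, passes to vectors for every shift [w]. *)
Lemma sum_matching_vector (Fs : seq {set gedge G}) : \sum_(F <- Fs) vec F =
  \row_i (\sum_(e : gedge G | glabel e == T i)
    (count (fun F : {set gedge G} => e \in F) Fs)%:R) + w *+ size Fs.
Proof.
elim: Fs => [|F Fs IH].
  by apply/rowP => i; rewrite big_nil !mxE big1 ?addr0.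
rewrite big_cons IH mulrS /vec /= addrACA; congr (_ + _).
apply/rowP => i; rewrite !mxE.
under [RHS]eq_bigr do rewrite natrD.
rewrite big_split /=; congr (_ + _).
rewrite -sum1_card natr_sum [LHS]big_mkcond [RHS]big_mkcond /=.
by apply: eq_bigr => e _; rewrite inE; case: (e \in F); case: (_ == _).
Qed.

Theorem snake_face_lattice :
  order_isomorphic
    (face (convex_hull (fun x => exists2 M, pm (G := G) M & x = vec M)))
    (fun F F' => F `<=` F')%classic
    (elementary G) (fun H H' => H \subset H').
Proof.
apply: face_lattice_elementary.
- move=> M [_ Mdeg]; have := Mdeg (corner_position T s t 0 SW).
  have -> : gverts (l := G) (corner_position T s t 0 SW).
    by apply/existsP; exists (Ordinal d_gt0); rewrite !inE eqxx.
  move=> /(_ isT); apply: contra_eq_neq => ->.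
  by rewrite (_ : finset _ = finset.set0) ?cards0 //; apply/setP => e; rewrite !inE.
- move=> [k e] eG; have [c [b cb]] := affine_state_edge e (ltn_ord k).
  exists c, b => M /state_of_pm[g ag ->]; rewrite -cb //.
  by rewrite mem_state_matching.
- move=> M Fs pmM FsP Fs0 cov.
  have [Gs [GsP sz eqc]] := snake_exchange pmM FsP Fs0 cov.
  exists Gs; split=> //; rewrite -(big_cons _ _ M Gs xpredT) !sum_matching_vector /= sz.
  congr (_ + _); apply/rowP => i; rewrite !mxE; apply: eq_bigr => e _.
  by rewrite -eqc.
Qed.

End SnakeFaces.

(** * Crossings and triangulations *)

Section Polygon.
Variable m : nat.
Notation V := 'I_m.+1.
Implicit Types (x a b c d u v : V) (A B : {set V}).

(** The number of counterclockwise steps from [x] to [v]. Cutting the cyclic order at [x] turns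
    [ccw] and [crosses] into linear inequalities within reach of [lia]. *)
Definition pos x v : nat := if x <= v then v - x else v + m.+1 - x.

Lemma pos_lt x v : pos x v < m.+1.
Proof. by rewrite /pos; have := ltn_ord v; case: (leqP x v); lia. Qed.

Lemma pos_self x : pos x x = 0.
Proof. by rewrite /pos leqnn subnn. Qed.

Lemma pos_inj x : injective (pos x).
Proof.
move=> u v; rewrite /pos => e; apply: val_inj => /=.
have := ltn_ord u; have := ltn_ord v; have := ltn_ord x.
by move: e; case: (leqP x u); case: (leqP x v); lia.
Qed.

Lemma pos_eq x u v : (pos x u == pos x v) = (u == v).
Proof. exact/inj_eq/pos_inj. Qed.

Lemma pos_neq0 x v : (0 < pos x v) = (v != x).
Proof. by rewrite lt0n -(pos_self x) pos_eq. Qed.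

Lemma pos_ordS x v : pos x (ordS v) = if (pos x v).+1 == m.+1 then 0 else (pos x v).+1.
Proof.
have xm := ltn_ord x; have vm := ltn_ord v; rewrite /pos /=.
have [e|ne] := eqVneq v.+1 m.+1.
  by rewrite e modnn; case: (leqP x 0) => ?; case: (leqP x v) => ?; case: eqP => ?; lia.
rewrite modn_small; last lia.
by case: (leqP x v.+1) => ?; case: (leqP x v) => ?; case: eqP => ?; lia.
Qed.

Lemma ccw_pos x a b c : ccw a b c = [|| pos x a < pos x b < pos x c,
  pos x b < pos x c < pos x a | pos x c < pos x a < pos x b].
Proof.
rewrite /ccw /pos; have := ltn_ord x; have := ltn_ord a; have := ltn_ord b.
have := ltn_ord c.
by case: (leqP x a); case: (leqP x b); case: (leqP x c); lia.
Qed.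

Lemma ccwC a b c : ccw a b c = ccw b c a.
Proof. by rewrite /ccw orbC -orbA. Qed.

Lemma crossesE a b c d : crosses [set a; b] [set c; d] =
  ccw a c b && ccw b d a || ccw a d b && ccw b c a.
Proof.
apply/existsP/orP => [[u /andP[uA /existsP[v /andP[vA]]]]|].
  move=> /existsP[w /andP[wB /existsP[z /andP[zB]]]].
  move: uA vA wB zB; rewrite !inE => /orP[]/eqP-> /orP[]/eqP-> /orP[]/eqP-> /orP[]/eqP->;
    rewrite /ccw; lia.
move=> [] H; exists a; rewrite !inE eqxx; apply/existsP; exists b; rewrite !inE eqxx orbT;
  apply/existsP; [exists c|exists d]; rewrite !inE eqxx ?orbT;
  apply/existsP; [exists d|exists c]; by rewrite !inE eqxx ?orbT H.
Qed.

Lemma crosses_setC a b c d : crosses [set a; b] [set c; d] = crosses [set c; d] [set a; b].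
Proof.
by rewrite !crossesE; apply/idP/idP; rewrite /ccw; lia.
Qed.

Definition separates (a b u v : nat) : bool :=
  (a < u < b) && ((v < a) || (b < v)) || (a < v < b) && ((u < a) || (b < u)).

Lemma crosses_pos x a b u v : pos x a < pos x b ->
  crosses [set a; b] [set u; v] = separates (pos x a) (pos x b) (pos x u) (pos x v).
Proof.
by move=> ab; rewrite crossesE !(ccw_pos x) /separates; apply/idP/idP; lia.
Qed.

Lemma boundary_segmentP a b :
  reflect (b = ordS a \/ a = ordS b) (boundary_segment [set a; b]).
Proof.
apply: (iffP existsP) => [[v /eqP e]|[->|->]].
- have: a \in [set a; b] by rewrite !inE eqxx.
  have: b \in [set a; b] by rewrite !inE eqxx orbT.
  have: v \in [set a; b] by rewrite e !inE eqxx.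
  have: ordS v \in [set a; b] by rewrite e !inE eqxx orbT.
  rewrite {3 4}e !inE => /orP[]/eqP h /orP[]/eqP h' /orP[]/eqP h'' /orP[]/eqP h''';
    subst; auto; left; congruence.
- by exists a.
- by exists b; rewrite finset.setUC.
Qed.

Lemma boundary_crosses A c d : boundary_segment A -> ~~ crosses A [set c; d].
Proof.
move=> /existsP[a /eqP->]; rewrite crossesE !(ccw_pos a) pos_self pos_ordS pos_self.
by case: eqP => /= *; lia.
Qed.

End Polygon.

Section Triangulation.
Variables (n : nat) (T : labelling n).
Notation V := 'I_n.+3.
Implicit Types (a b c d u v x : V).

Definition seg a b : bool := [set a; b] \in codom T.

Lemma segC a b : seg a b = seg b a.
Proof. by rewrite /seg finset.setUC. Qed.

Lemma segP a b : reflect (exists i, T i = [set a; b]) (seg a b).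
Proof. by apply: (iffP codomP) => -[i e]; exists i. Qed.

Lemma ordS_neq a : ordS a != a.
Proof. by rewrite -(pos_neq0 a) pos_ordS pos_self. Qed.

Hypothesis hT : triangulation T.

Lemma card_label i : #|T i| = 2.
Proof.
case: hT => _ dT bT _ _; rewrite -(fintype.splitK i); case: (fintype.split i) => j /=.
  by have /andP[/eqP] := dT j.
by have /existsP[a /eqP->] := bT j; rewrite cards2 eq_sym ordS_neq.
Qed.

Lemma seg_neq a b : seg a b -> a != b.
Proof. by move=> /segP[i eT]; have := card_label i; rewrite eT cards2; case: eqP. Qed.

Lemma label_boundary i a b : T i = [set a; b] ->
  boundary_segment [set a; b] \/ exists j : 'I_n, i = lshift n.+3 j.
Proof.
case: hT => _ _ bT _ _; rewrite -(fintype.splitK i); case: (fintype.split i) => j /= <-.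
  by right; exists j.
by left.
Qed.

(** There are as many boundary labels as sides of the polygon, and they are distinct, so every side
    is labelled. *)
Lemma seg_ordS a : seg a (ordS a).
Proof.
case: (hT) => iT _ bT _ _.
have /choice[f fP] : forall j : 'I_n.+3, exists a, T (rshift n j) = [set a; ordS a].
  by move=> j; have /existsP[b /eqP] := bT j; exists b.
have [g fK gK] : bijective f.
  apply: injF_bij => i j eqf; apply: (@rshift_inj n).
  by apply: iT; rewrite !fP eqf.
by apply/segP; exists (rshift n (g a)); rewrite fP gK.
Qed.

Lemma seg_noncrossing a b c d : seg a b -> seg c d ->
  ~~ crosses [set a; b] [set c; d].
Proof.
move=> /segP[i eab] /segP[j ecd]; case: (hT) => _ _ _ nc _.
have [/boundary_crosses->//|[i' ei]] := label_boundary eab.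
have [/boundary_crosses h|[j' ej]] := label_boundary ecd.
  by rewrite crosses_setC h.
by rewrite -eab -ecd ei ej nc.
Qed.

Lemma seg_boundary a b : boundary_segment [set a; b] -> seg a b.
Proof. by move=> /boundary_segmentP[->|->]; rewrite ?seg_ordS // segC seg_ordS. Qed.

Lemma seg_maximal a b : a != b ->
  (forall c d, seg c d -> ~~ crosses [set a; b] [set c; d]) -> seg a b.
Proof.
move=> ab nc; have [/seg_boundary//|nb] := boolP (boundary_segment [set a; b]).
case: (hT) => _ dT _ _ /(_ [set a; b])[||i eT].
- by rewrite /polygon_diagonal cards2 ab.
- move=> i; have /andP[/cards2P[c [d [_ eT]]] _] := dT i.
  by rewrite eT; apply: nc; apply/segP; exists (lshift n.+3 i).
- by apply/segP; exists (lshift n.+3 i).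
Qed.

Lemma apex_exists a b : seg a b -> 1 < pos a b ->
  exists c, [/\ 0 < pos a c < pos a b, seg a c & seg c b].
Proof.
move=> ab b_gt1; pose P c := (0 < pos a c < pos a b) && seg a c.
have P0 : P (ordS a) by rewrite /P seg_ordS pos_ordS pos_self andbT.
(* The last neighbour c of a before b: a diagonal crossing cb could only end at
   a, and its other end would be a later neighbour. *)
case: (arg_maxnP (pos a) P0) => c /andP[cab ac] cmax.
exists c; split=> //; have [eS|neS] := eqVneq (pos a b) (pos a c).+1.
  suff -> : b = ordS c by apply: seg_ordS.
  apply: (@pos_inj _ a); rewrite pos_ordS eS; case: eqP => // e.
  by have := pos_lt a b; lia.
apply: seg_maximal => [|u v uv]; first by apply/eqP => e; move: cab; rewrite e; lia.
apply/negP; rewrite (@crosses_pos _ a); last lia.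
have := seg_noncrossing ab uv; rewrite (@crosses_pos _ a) ?pos_self; last lia.
have := seg_noncrossing ac uv; rewrite (@crosses_pos _ a) ?pos_self; last lia.
move=> h1 h2 h3.
have [] : pos a u = 0 /\ pos a c < pos a v < pos a b \/
          pos a v = 0 /\ pos a c < pos a u < pos a b.
  by move: h1 h2 h3; rewrite /separates; lia.
- move=> [/eqP]; rewrite -[0](pos_self a) pos_eq => /eqP eu hv; subst u.
  by have := cmax v; rewrite /P uv andbT; lia.
- move=> [/eqP]; rewrite -[0](pos_self a) pos_eq => /eqP ev hu; subst v.
  by have := cmax u; rewrite /P segC uv andbT; lia.
Qed.

(** With two different apices, one of the pairs [ac], [db] and [ad], [cb] would cross. *)
Lemma apex_unique a b c d : 0 < pos a c < pos a b -> 0 < pos a d < pos a b ->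
  seg a c -> seg c b -> seg a d -> seg d b -> c = d.
Proof.
move=> cab dab ac cb ad db; apply: (@pos_inj _ a).
have := seg_noncrossing ac db; have := seg_noncrossing ad cb.
by rewrite !(@crosses_pos _ a) ?pos_self /separates; lia.
Qed.

Lemma seg_diagonal a b : seg a b -> ~~ boundary_segment [set a; b] ->
  exists i : 'I_n, T (lshift n.+3 i) = [set a; b].
Proof.
move=> /segP[i eT] nb; have [|[j ij]] := label_boundary eT.
  by rewrite (negPf nb).
by exists j; rewrite -ij.
Qed.

Lemma crosses_diagonal a b c d : seg a b -> crosses [set a; b] [set c; d] ->
  exists i : 'I_n, T (lshift n.+3 i) = [set a; b].
Proof.
by move=> ab; apply: contraPP => nT /=; apply/negP/boundary_crosses;
  apply: contrapT => /negP/(seg_diagonal ab).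
Qed.

Lemma quadrilateral (i : 'I_n) : exists a b c d,
  [/\ T (lshift n.+3 i) = [set a; b], 0 < pos a c < pos a b /\ pos a b < pos a d,
      seg a c /\ seg c b & seg b d /\ seg d a].
Proof.
case: (hT) => _ /(_ i)/andP[/cards2P[a [b [ab eT]]] nb] _ _ _.
have sab : seg a b by apply/segP; exists (lshift n.+3 i).
move: nb; rewrite eT => /boundary_segmentP nb.
have posa : 1 < pos a b.
  have : 0 < pos a b by rewrite pos_neq0 eq_sym.
  rewrite leq_eqVlt => /predU1P[e|//]; case: nb; left; apply: (@pos_inj _ a).
  by rewrite pos_ordS pos_self -e.
have posb : 1 < pos b a.
  have : 0 < pos b a by rewrite pos_neq0.
  rewrite leq_eqVlt => /predU1P[e|//]; case: nb; right; apply: (@pos_inj _ b).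
  by rewrite pos_ordS pos_self -e.
have [c [cab ac cb]] := apex_exists sab posa.
have [|d [dba bd da]] := @apex_exists b a _ posb; first by rewrite segC.
exists a, b, c, d; split=> //; split=> //.
have : ccw b d a by rewrite (ccw_pos b) pos_self dba.
by rewrite (ccw_pos a) pos_self; lia.
Qed.

End Triangulation.

(** * Flips and mutations *)

Lemma set2_eq (X : finType) (a b c d : X) : [set a; b] = [set c; d] ->
  a = c /\ b = d \/ a = d /\ b = c.
Proof.
move=> e; have: a \in [set c; d] by rewrite -e set21.
have: b \in [set c; d] by rewrite -e set22.
have: c \in [set a; b] by rewrite e set21.
have: d \in [set a; b] by rewrite e set22.
rewrite !inE => /orP[]/eqP-> /orP[]/eqP-> /orP[]/eqP h /orP[]/eqP h';
  by subst; auto; left; split; congruence.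
Qed.

Section Flip.
Variables (n : nat) (T : labelling n).
Notation V := 'I_n.+3.
Implicit Types (a b c d u v w x : V).
Hypothesis hT : triangulation T.

(* The counterclockwise order is a, c, b, d. *)
Definition quad (A : {set V}) a b c d : Prop :=
  [/\ A = [set a; b], ccw a c b && ccw b d a,
      seg T a c && seg T c b & seg T b d && seg T d a].

Lemma quad_exists (i : 'I_n) : exists a b c d, quad (T (lshift n.+3 i)) a b c d.
Proof.
have [a [b [c [d [-> [h1 h2] [h3 h4] [h5 h6]]]]]] := quadrilateral hT i.
exists a, b, c, d; split=> //; rewrite ?h3 ?h4 ?h5 ?h6 //.
by rewrite !(ccw_pos a) pos_self; lia.
Qed.

Lemma ccw_neq a b c : ccw a b c -> [/\ a != b, b != c & a != c].
Proof. by rewrite /ccw => h; split; apply/eqP => e; move: h; rewrite e; lia. Qed.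

Lemma quad_apices A a b c d : A \in codom T -> quad A a b c d ->
  apices T A = [set c; d].
Proof.
move=> AT [eA cc /andP[ac cb] /andP[bd da]].
have ab : seg T a b by rewrite /seg -eA.
have {cc} : 0 < pos a c < pos a b /\ pos a b < pos a d.
  by move: cc; rewrite !(ccw_pos a) pos_self; lia.
move=> [pcb pbd]; rewrite eA; apply/setP => v; rewrite !inE negb_or.
apply/andP/orP => [[/andP[va vb] /forall_inP sv]|]; last first.
  move=> e; split.
    by case: e => /eqP->; rewrite -!(pos_eq a) ?pos_self; lia.
  apply/forall_inP => x; rewrite !inE -/(seg T v x).
  by case: e => /eqP-> /orP[]/eqP->; rewrite // segC.
have sva : seg T a v by rewrite segC; apply: sv; rewrite set21.
have svb : seg T v b by apply: sv; rewrite set22.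
have [lt|gt] := ltnP (pos a v) (pos a b).
  left; apply/eqP; apply: (apex_unique hT (b := b) (a := a)) => //.
  by rewrite lt pos_neq0 va.
right; rewrite -(pos_eq a).
move: va vb; rewrite -!(pos_eq a) pos_self => va vb.
have := seg_noncrossing hT sva bd.
rewrite segC in svb; rewrite segC in da; have := seg_noncrossing hT svb da.
rewrite (crosses_setC b) !(@crosses_pos _ a) ?pos_self; try lia.
by rewrite /separates; lia.
Qed.

Variable k : 'I_n.
Notation K := (lshift n.+3 k).
Variables a b c d : V.
Hypothesis quadK : quad (T K) a b c d.

Lemma flipK i : flip T k i = if i == K then [set c; d] else T i.
Proof.
rewrite /flip; case: eqP => // ->.
by rewrite (quad_apices (codom_f T K) quadK).
Qed.

Lemma quad_pos : 0 < pos a c < pos a b /\ pos a b < pos a d.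
Proof. by case: quadK => _ + _ _; rewrite !(ccw_pos a) pos_self; lia. Qed.

Lemma quad_seg : [/\ seg T a b, seg T a c, seg T b c, seg T b d & seg T a d].
Proof.
case: quadK => eK _ /andP[ac cb] /andP[bd da].
by split=> //; [rewrite /seg -eK codom_f|rewrite segC|rewrite segC].
Qed.

Lemma quad_crosses : crosses [set c; d] [set a; b].
Proof.
have [h1 h2] := quad_pos.
by rewrite (@crosses_pos _ a) ?pos_self /separates; lia.
Qed.

Lemma seg_cd : ~~ seg T c d.
Proof.
have [ab _ _ _ _] := quad_seg.
by apply/negP => /(seg_noncrossing hT) /(_ ab); rewrite quad_crosses.
Qed.

(** A segment of [T] crosses none of the four sides, so to cross [cd] it must join two vertices of
    the quadrilateral; only [ab] does. *)
Lemma crosses_other_diagonal u v : seg T u v -> crosses [set c; d] [set u; v] ->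
  [set u; v] = [set a; b].
Proof.
move=> uv; have [h1 h2] := quad_pos; have [ab ac bc bd ad] := quad_seg.
have := seg_noncrossing hT uv ab; have := seg_noncrossing hT uv ac.
have := seg_noncrossing hT uv bc; have := seg_noncrossing hT uv bd.
have := seg_noncrossing hT uv ad; rewrite !(crosses_setC u v).
rewrite [[set b; c]]finset.setUC !(@crosses_pos _ a) ?pos_self /separates; try lia.
move=> H1 H2 H3 H4 H5 H6.
have [[/eqP e1 /eqP e2]|[/eqP e1 /eqP e2]] : pos a u = 0 /\ pos a v = pos a b \/
    pos a v = 0 /\ pos a u = pos a b by lia.
  by move: e1 e2; rewrite -[0](pos_self a) !pos_eq => /eqP-> /eqP->.
by move: e1 e2; rewrite -[0](pos_self a) !pos_eq => /eqP-> /eqP->; rewrite finset.setUC.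
Qed.

(** The source of maximality after a flip: a segment crossing [ab] and nothing else of [T] cannot
    leave the quadrilateral, hence joins [c] and [d]. *)
Lemma crosses_only_diagonal u v : crosses [set u; v] [set a; b] ->
  (forall x y, seg T x y -> [set x; y] != [set a; b] -> ~~ crosses [set u; v] [set x; y]) ->
  [set u; v] = [set c; d].
Proof.
have [h1 h2] := quad_pos; have [ab ac bc bd ad] := quad_seg => Huv nc.
have neq x y : x \notin [set a; b] -> [set x; y] != [set a; b].
  by apply: contraNneq => <-; rewrite set21.
have cN : c \notin [set a; b] by rewrite !inE -!(pos_eq a) pos_self; lia.
have dN : d \notin [set a; b] by rewrite !inE -!(pos_eq a) pos_self; lia.
rewrite segC in ac; rewrite segC in bc; rewrite segC in bd; rewrite segC in ad.
have := nc _ _ ac (neq _ _ cN); have := nc _ _ bc (neq _ _ cN).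
have := nc _ _ bd (neq _ _ dN); have := nc _ _ ad (neq _ _ dN).
move: Huv; rewrite !(crosses_setC u v).
rewrite [[set c; a]]finset.setUC [[set d; b]]finset.setUC [[set d; a]]finset.setUC.
rewrite !(@crosses_pos _ a) ?pos_self /separates; try lia.
move=> H1 H2 H3 H4 H5.
have [[/eqP e1 /eqP e2]|[/eqP e1 /eqP e2]] : pos a u = pos a c /\ pos a v = pos a d \/
    pos a v = pos a c /\ pos a u = pos a d by lia.
  by move: e1 e2; rewrite !pos_eq => /eqP-> /eqP->.
by move: e1 e2; rewrite !pos_eq => /eqP-> /eqP->; rewrite finset.setUC.
Qed.

Lemma flip_triangulation : triangulation (flip T k).
Proof.
case: (hT) => iT dT bT nc maxT; have [eK _ _ _] := quadK.
have cdT i : T i != [set c; d].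
  by apply: contraNneq seg_cd => e; rewrite /seg -e codom_f.
have ncK (j : 'I_n) : j != k -> ~~ crosses [set c; d] (T (lshift n.+3 j)).
  move=> jk; have /cards2P[u [v [_ eT]]] : #|T (lshift n.+3 j)| == 2 by rewrite card_label.
  rewrite eT; apply/negP => /crosses_other_diagonal; rewrite /seg -eT codom_f -eK.
  by move=> /(_ isT)/iT/lshift_inj/eqP; rewrite (negPf jk).
split.
- move=> i j; rewrite !flipK; do 2![case: eqP => [->|_]] => //.
  + by move=> /esym/eqP; rewrite (negPf (cdT _)).
  + by move=> /eqP; rewrite (negPf (cdT _)).
  + exact: iT.
- move=> i; rewrite flipK; case: eqP => // _; rewrite /polygon_diagonal cards2.
  have -> : c != d by apply: contraTneq quad_crosses => ->; rewrite crossesE /ccw; lia.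
  by apply: contraL quad_crosses => /boundary_crosses->.
- by move=> j; rewrite flipK eq_sym eq_lrshift.
- move=> i j; rewrite !flipK !(inj_eq (@lshift_inj _ _)).
  case: eqP => [_|/eqP ik]; case: eqP => [_|/eqP jk] //.
  + by rewrite crossesE /ccw; lia.
  + exact: ncK.
  + have /cards2P[u [v [_ eT]]] : #|T (lshift n.+3 i)| == 2 by rewrite card_label.
    by rewrite eT crosses_setC -eT ncK.
move=> D dD ncD.
have /andP[/cards2P[u [v [uv eD]]] _] := dD.
(* If [D] crosses the removed diagonal, it is the new one. Otherwise maximality of [T] gives [D] a
   label, which is not that of the removed diagonal, as the latter crosses [cd]. *)
have [cr|ncr] := boolP (crosses D (T K)).
  exists k; rewrite flipK eqxx eD; apply/esym/crosses_only_diagonal.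
    by rewrite -eD -eK.
  move=> x y /segP[i ei] neq; rewrite -eD.
  have [bd|[j ej]] := label_boundary hT ei.
    by rewrite eD crosses_setC boundary_crosses.
  have := ncD j; rewrite flipK -ej ei; case: eqP => // iK.
  by move: neq; rewrite -ei iK eK eqxx.
have [j|j ej] := maxT D dD.
  have [->//|jk] := eqVneq j k.
  by have := ncD j; rewrite flipK (inj_eq (@lshift_inj _ _)) (negPf jk).
exists j; rewrite flipK (inj_eq (@lshift_inj _ _)); case: eqP => // jk.
have := ncD k; rewrite flipK eqxx -ej jk eK.
by rewrite crosses_setC quad_crosses.
Qed.

End Flip.

(** * Quivers of flipped triangulations *)

Section Quiver.
Variables (n : nat).
Notation V := 'I_n.+3.
Implicit Types (T : labelling n) (a b c d u v w x : V).

Definition arrow T (A B : {set V}) v u w : bool :=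
  [&& ccw v u w, A == [set v; u], B == [set v; w] & seg T u w].

Lemma arrow_common T A B v u w v' u' w' :
  arrow T A B v u w -> A = [set v'; u'] -> B = [set v'; w'] -> u' != w' ->
  [/\ v' = v, u' = u & w' = w].
Proof.
move=> /and4P[cc /eqP-> /eqP-> _] /set2_eq eA /set2_eq eB uw.
have [vu uw' vw] := ccw_neq cc.
case: eA => [[? ?]|[? ?]]; case: eB => [[? ?]|[? ?]]; subst => //;
  by rewrite ?eqxx in vu uw uw' vw.
Qed.

Lemma ccw_asym a b c : ccw a b c -> ccw b a c = false.
Proof. by rewrite /ccw; lia. Qed.

Lemma quiver_ofP T i j :
  reflect (exists v u w, arrow T (T i) (T j) v u w) (0 < quiver_of T i j).
Proof.
apply: (iffP card_gt0P) => [[[[v u] w]]|[v [u [w h]]]].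
  by rewrite inE => h; exists v, u, w.
by exists (v, u, w); rewrite inE.
Qed.

(** Two sides with a common endpoint determine the triangle, so arrows are never multiple and can be
    handled as booleans. *)
Lemma quiver_of_le1 T i j : quiver_of T i j <= 1.
Proof.
apply/card_le1_eqP => -[[v u] w] [[v' u'] w']; rewrite !inE => h h'.
have /and4P[/ccw_neq[_ uw _] /eqP eA /eqP eB _] := h.
by have [-> -> ->] := arrow_common h' eA eB uw.
Qed.

Lemma quiver_of_bool T i j : quiver_of T i j = (0 < quiver_of T i j).
Proof. by have := quiver_of_le1 T i j; case: (quiver_of T i j) => [|[]]. Qed.

Lemma quiver_of_eq T i j (p : bool) :
  (p <-> exists v u w, arrow T (T i) (T j) v u w) -> quiver_of T i j = p.
Proof.
move=> pP; rewrite quiver_of_bool; congr (nat_of_bool _).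
by apply/quiver_ofP/idP => /pP.
Qed.

Section Mutation.
Variables (T : labelling n) (k : 'I_n).
Hypothesis hT : triangulation T.
Notation K := (lshift n.+3 k).
Variables a b c d : V.
Hypothesis quadK : quad T (T K) a b c d.

Lemma quiver_to_diagonal i :
  quiver_of T i K = (T i == [set a; c]) || (T i == [set b; d]).
Proof.
have [eK /andP[cc1 cc2] /andP[ac cb] /andP[bd da]] := quadK.
apply: quiver_of_eq; split=> [|[v [u [w /and4P[cc /eqP eA /eqP eB uw]]]]].
  move=> /orP[]/eqP->; [exists a, c, b|exists b, d, a]; rewrite /arrow eqxx.
    by rewrite cc1 eK cb eqxx.
  by rewrite cc2 eK finset.setUC da eqxx.
have : u \in apices T (T K).
  have [vu uw' _] := ccw_neq cc.
  rewrite eB !inE negb_or eq_sym vu uw' /=; apply/forall_inP => x.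
  rewrite !inE => /orP[]/eqP-> //; rewrite finset.setUC -eA; exact: codom_f.
rewrite (quad_apices hT (codom_f T K) quadK) !inE => ucd.
move: cc; rewrite eA; case/set2_eq: (etrans (esym eK) eB) ucd => -[<- <-] /orP[]/eqP-> cc.
- by rewrite eqxx.
- by move: cc cc2; rewrite /ccw; lia.
- by move: cc cc1; rewrite /ccw; lia.
- by rewrite eqxx orbT.
Qed.

Lemma quiver_from_diagonal i :
  quiver_of T K i = (T i == [set b; c]) || (T i == [set a; d]).
Proof.
have [eK /andP[cc1 cc2] /andP[ac cb] /andP[bd da]] := quadK.
apply: quiver_of_eq; split=> [|[v [u [w /and4P[cc /eqP eA /eqP eB uw]]]]].
  move=> /orP[]/eqP->; [exists b, a, c|exists a, b, d]; rewrite /arrow eqxx.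
    by rewrite ccwC cc1 eK finset.setUC ac eqxx.
  by rewrite ccwC cc2 eK bd eqxx.
have : w \in apices T (T K).
  have [vu uw' vw] := ccw_neq cc.
  rewrite eA !inE negb_or eq_sym vw eq_sym uw' /=; apply/forall_inP => x.
  rewrite !inE => /orP[]/eqP->; rewrite finset.setUC //-eB; exact: codom_f.
rewrite (quad_apices hT (codom_f T K) quadK) !inE => ucd.
move: cc; rewrite eB; case/set2_eq: (etrans (esym eK) eA) ucd => -[<- <-] /orP[]/eqP-> cc.
- by move: cc cc1; rewrite /ccw; lia.
- by rewrite eqxx orbT.
- by rewrite eqxx.
- by move: cc cc2; rewrite /ccw; lia.
Qed.

(** Arrows in triangles whose third side is neither diagonal of the quadrilateral. Between labels
    other than [K] they survive the flip; the remaining arrows lie in the two triangles that it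
    replaces. *)
Definition outer (i j : 'I_(n + n.+3)) : bool := [exists v, exists u, exists w,
  [&& arrow T (T i) (T j) v u w, [set u; w] != [set a; b] & [set u; w] != [set c; d]]].

Lemma outerP i j : reflect (exists v u w, [&& arrow T (T i) (T j) v u w,
  [set u; w] != [set a; b] & [set u; w] != [set c; d]]) (outer i j).
Proof.
apply: (iffP existsP) => [[v /existsP[u /existsP[w h]]]|[v [u [w h]]]].
  by exists v, u, w.
by exists v; apply/existsP; exists u; apply/existsP; exists w.
Qed.

Lemma quiver_ofE i j : quiver_of T i j = [|| outer i j,
  (T i == [set b; c]) && (T j == [set a; c]) | (T i == [set a; d]) && (T j == [set b; d])].
Proof.
have [eK /andP[cc1 cc2] /andP[ac cb] /andP[bd da]] := quadK.
have ab : seg T a b by rewrite /seg -eK codom_f.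
apply: quiver_of_eq; split=> [|[v [u [w h]]]].
  case/or3P => [/outerP[v [u [w /and3P[h _ _]]]]|/andP[/eqP-> /eqP->]|/andP[/eqP-> /eqP->]].
  - by exists v, u, w.
  - exists c, b, a; rewrite /arrow [[set c; b]]finset.setUC [[set c; a]]finset.setUC !eqxx.
    by rewrite -ccwC cc1 segC ab.
  - exists d, a, b; rewrite /arrow [[set d; b]]finset.setUC [[set d; a]]finset.setUC !eqxx.
    by rewrite -ccwC cc2 ab.
have /and4P[cc /eqP eA /eqP eB uw] := h; have [vu uw' vw] := ccw_neq cc.
have [e|nab] := eqVneq [set u; w] [set a; b]; last first.
  rewrite orbC; apply/orP; right; apply/outerP; exists v, u, w; rewrite h nab /=.
  apply: contraTneq uw => e; rewrite /seg e; exact: seg_cd quadK.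
have : v \in apices T (T K).
  rewrite eK -e !inE negb_or vu vw /=; apply/forall_inP => x.
  by rewrite !inE => /orP[]/eqP->; rewrite -?eA -?eB; apply: codom_f.
rewrite (quad_apices hT (codom_f T K) quadK) !inE => /orP vcd.
rewrite eA eB; case/set2_eq: e vcd => -[eu ew] [] /eqP ev; subst u v w.
- by rewrite (ccw_asym cc1) in cc.
- by rewrite [[set d; a]]finset.setUC [[set d; b]]finset.setUC !eqxx !orbT.
- by rewrite [[set c; a]]finset.setUC [[set c; b]]finset.setUC !eqxx !orbT.
- by rewrite (ccw_asym cc2) in cc.
Qed.

Definition quad_side (A : {set V}) : bool :=
  [|| A == [set a; c], A == [set b; d], A == [set b; c] | A == [set a; d]].

Lemma quad_sideP v u : quad_side [set v; u] ->
  (v \in [set a; b]) && (u \in [set c; d]) || (v \in [set c; d]) && (u \in [set a; b]).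
Proof.
by case/or4P => /eqP/set2_eq[] [-> ->]; rewrite !inE !eqxx ?orbT.
Qed.

(** If two sides of the quadrilateral meet at an end of one diagonal, their other ends are those of
    the other diagonal, so the third side is one that [outer] excludes. *)
Lemma outer_quad_side i j : quad_side (T i) -> quad_side (T j) -> ~~ outer i j.
Proof.
move=> qi qj; apply/outerP => -[v [u [w /and3P[/and4P[cc /eqP eA /eqP eB _] nab ncd]]]].
have [_ uw _] := ccw_neq cc.
have [_ /andP[/ccw_neq[ac cb ab] /ccw_neq[bd da _]] _ _] := quadK.
have sub2 (x y : V) : u \in [set x; y] -> w \in [set x; y] -> [set u; w] = [set x; y].
  rewrite !inE => /orP[]/eqP eu /orP[]/eqP ew; rewrite eu ew ?eqxx // in uw *.
  by rewrite finset.setUC.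
have disj : v \in [set a; b] -> v \in [set c; d] -> False.
  rewrite !inE => /orP[]/eqP-> /orP[]/eqP e; move: ac cb bd da;
    by rewrite e eqxx.
rewrite eA in qi; rewrite eB in qj.
move: (quad_sideP qi) (quad_sideP qj) => /orP[]/andP[v1 u1] /orP[]/andP[v2 w2].
- by rewrite (sub2 _ _ u1 w2) eqxx in ncd.
- by case: disj.
- by case: disj.
- by rewrite (sub2 _ _ u1 w2) eqxx in nab.
Qed.

(** Together with [outer_quad_side], this ensures that the truncated subtraction in [mutate_quiver]
    cancels only arrows between sides of the quadrilateral. *)
Lemma outer_asym i j : outer i j -> ~~ outer j i.
Proof.
move=> /outerP[v [u [w /and3P[h _ _]]]]; apply/outerP => -[v' [u' [w']]].
move=> /and3P[/and4P[cc' /eqP eA /eqP eB _] _ _].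
have /and4P[cc _ _ _] := h; have [_ uw _] := ccw_neq cc'; rewrite eq_sym in uw.
have [e1 e2 e3] := arrow_common h eB eA uw; subst.
by move: cc; rewrite ccwC ccwC (ccw_asym cc').
Qed.

End Mutation.

Lemma seg_flip T k a b c d u v : triangulation T -> quad T (T (lshift n.+3 k)) a b c d ->
  [set u; v] != [set a; b] -> [set u; v] != [set c; d] ->
  seg (flip T k) u v = seg T u v.
Proof.
move=> hT quadK nab ncd; have [eK _ _ _] := quadK.
apply/segP/segP => -[i ei]; exists i; move: ei; rewrite (flipK hT quadK);
  case: eqP => [->|//] e; first by rewrite -e eqxx in ncd.
by rewrite -e eK eqxx in nab.
Qed.

(** The cyclic order [a, c, b, d], read from [c], is [c, b, d, a]; thus [b] and [a] become the
    apices of the new diagonal. *)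
Lemma quad_flip T k a b c d : triangulation T -> quad T (T (lshift n.+3 k)) a b c d ->
  quad (flip T k) (flip T k (lshift n.+3 k)) c d b a.
Proof.
move=> hT quadK; have [_ /andP[cc1 cc2] /andP[ac cb] /andP[bd da]] := quadK.
have [nac ncb nab] := ccw_neq cc1; have [nbd nda _] := ccw_neq cc2.
have [p1 p2] := quad_pos quadK.
have S u v : seg T u v -> [set u; v] != [set a; b] -> seg (flip T k) u v.
  move=> uv uvab; rewrite (seg_flip hT quadK) //; apply: contraTneq uv => e.
  by rewrite /seg e; apply: seg_cd quadK.
have neq x y : x \notin [set a; b] -> [set x; y] != [set a; b].
  by apply: contraNneq => <-; rewrite set21.
have cN : c \notin [set a; b] by rewrite !inE negb_or eq_sym nac.
have dN : d \notin [set a; b] by rewrite !inE negb_or nda eq_sym nbd.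
split; rewrite ?(flipK hT quadK) ?eqxx //.
- by rewrite !(ccw_pos a) pos_self; move: p1 p2; clear; lia.
- by rewrite S ?neq // segC S ?neq // segC.
- by rewrite S ?neq // segC S ?neq // segC.
Qed.

Lemma outer_flip T k a b c d i j : triangulation T ->
  quad T (T (lshift n.+3 k)) a b c d -> i != lshift n.+3 k -> j != lshift n.+3 k ->
  outer (flip T k) c d b a i j = outer T a b c d i j.
Proof.
move=> hT quadK iK jK; rewrite /outer /arrow !(flipK hT quadK) (negPf iK) (negPf jK).
apply: eq_existsb => v; apply: eq_existsb => u; apply: eq_existsb => w.
rewrite [[set b; a]]finset.setUC.
have [e|nab] := eqVneq [set u; w] [set a; b]; first by rewrite !andbF.
have [e|ncd] := eqVneq [set u; w] [set c; d]; first by rewrite !andbF.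
by rewrite (seg_flip hT quadK).
Qed.

Lemma quiver_of_loop T i : quiver_of T i i = 0.
Proof.
rewrite (@quiver_of_eq _ _ _ false) //; split=> // -[v [u [w]]].
move=> /and4P[/ccw_neq[vu uw _] /eqP-> /eqP/set2_eq[[_ e]|[e1 e2]] _].
  by rewrite e eqxx in uw.
by rewrite e2 eqxx in vu.
Qed.

Lemma quiver_of_flip T k i j : triangulation T ->
  quiver_of (flip T k) i j = mutate_quiver (quiver_of T) (lshift n.+3 k) i j.
Proof.
move=> hT; have [a [b [c [d quadK]]]] := quad_exists hT k.
have hT' := flip_triangulation hT quadK; have quadK' := quad_flip hT quadK.
have fE := flipK hT quadK; rewrite /mutate_quiver.
have [->|iK] /= := eqVneq i (lshift n.+3 k).
  have [->|jK] := eqVneq j (lshift n.+3 k); first by rewrite !quiver_of_loop.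
  rewrite (quiver_from_diagonal hT' quadK') (quiver_to_diagonal hT quadK).
  by rewrite fE (negPf jK) [[set d; b]]finset.setUC [[set c; a]]finset.setUC orbC.
have [->|jK] /= := eqVneq j (lshift n.+3 k).
  rewrite (quiver_to_diagonal hT' quadK') (quiver_from_diagonal hT quadK).
  by rewrite fE (negPf iK) [[set d; a]]finset.setUC [[set c; b]]finset.setUC.
rewrite !(quiver_to_diagonal hT quadK) !(quiver_from_diagonal hT quadK).
rewrite (quiver_ofE hT' quadK') !(quiver_ofE hT quadK) !(outer_flip hT quadK) //.
rewrite !fE (negPf iK) (negPf jK).
rewrite [[set d; b]]finset.setUC [[set c; b]]finset.setUC [[set c; a]]finset.setUC.
rewrite [[set d; a]]finset.setUC.
have := @outer_asym T a b c d i j.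
have := outer_quad_side quadK (i := i) (j := j).
have := outer_quad_side quadK (i := j) (j := i).
have [_ /andP[/ccw_neq[ac cb ab] /ccw_neq[bd da _]] _ _] := quadK.
rewrite /quad_side.
have neq x y z w : x \notin [set z; w] -> [set x; y] != [set z; w].
  by apply: contraNneq => <-; rewrite set21.
(* A label is at most one of the four sides, which leaves five cases for each of [i] and [j]. *)
have excl A : (A == [set a; c]) + (A == [set b; d]) + (A == [set b; c]) +
    (A == [set a; d]) <= 1.
  have e1 : [set a; c] != [set b; c] by apply: neq; rewrite !inE negb_or ab ac.
  have e2 : [set a; c] != [set b; d] by apply: neq; rewrite !inE negb_or ab eq_sym da.
  have e3 : [set a; d] != [set b; c] by apply: neq; rewrite !inE negb_or ab ac.
  have e4 : [set a; d] != [set b; d] by apply: neq; rewrite !inE negb_or ab eq_sym da.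
  have cd : c != d.
    by apply: contraTneq (quad_crosses quadK) => ->; rewrite crossesE /ccw; lia.
  have e5 : [set c; a] != [set a; d] by apply: neq; rewrite !inE negb_or cd eq_sym ac.
  have e6 : [set c; b] != [set b; d] by apply: neq; rewrite !inE negb_or cd cb.
  rewrite finset.setUC in e5; rewrite finset.setUC in e6.
  have [->|_] := eqVneq A [set a; c]; first by rewrite (negPf e1) (negPf e2) (negPf e5).
  have [->|_] := eqVneq A [set b; d].
    by rewrite eq_sym (negPf e6) eq_sym (negPf e4).
  have [->|_] := eqVneq A [set b; c]; first by rewrite eq_sym (negPf e3).
  by case: (_ == _).
move: (excl (T i)) (excl (T j)).
case: (T i == [set a; c]); case: (T i == [set b; d]); case: (T i == [set b; c]);
  case: (T i == [set a; d]) => //= _;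
case: (T j == [set a; c]); case: (T j == [set b; d]); case: (T j == [set b; c]);
  case: (T j == [set a; d]) => //= _ h1 h2;
move: (outer T a b c d i j) (outer T a b c d j i) h1 h2 => p p';
  case: p; case: p' => /= h1 h2 h3;
  first [done | by have := h1 isT isT | by have := h2 isT isT | by have := h3 isT].
Qed.

End Quiver.

(** * Lambda lengths *)

Section LambdaLengths.
Variables (n : nat) (T : labelling n).
Notation V := 'I_n.+3.
Hypothesis hT : triangulation T.
Variables (F : fieldType) (x : {set V} -> F).
Hypothesis x_neq0 : forall i, x (T i) != 0%R.
Implicit Types (a b c d : V).
Local Open Scope ring_scope.

Definition det2 (p q : F * F) : F := p.1 * q.2 - p.2 * q.1.

(** Induction over the triangles under [ab]. The vector at the apex [c] is [al] times [va] plus [be]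
    times [vb], and the determinants prescribed on [ac] and [cb] force both coefficients. By
    noncrossing, any other segment between [a] and [b] lies on one side of [c]. *)
Lemma seg_vectors_between k a b va vb : (b - a <= k)%N -> (a < b)%N -> seg T a b ->
  det2 va vb = x [set a; b] ->
  exists v : V -> F * F, [/\ v a = va, v b = vb &
    forall c d, (a <= c)%N -> (c < d)%N -> (d <= b)%N -> seg T c d ->
      det2 (v c) (v d) = x [set c; d]].
Proof.
elim: k a b va vb => [|k IH] a b va vb; first by lia.
move=> bak ab sab eab; have pab : pos a b = (b - a)%N by rewrite /pos ltnW.
have [ba1|ba1] := leqP (pos a b) 1.
  exists (fun w : V => if w == a then va else vb); split.
  - by rewrite eqxx.
  - by rewrite -(inj_eq val_inj) gtn_eqF.
  - move=> c d ac cd db _.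
    have -> : c = a by apply: val_inj => /=; lia.
    have -> : d = b by apply: val_inj => /=; lia.
    by rewrite eqxx -(inj_eq val_inj) gtn_eqF.
have [c [pc ac cb]] := apex_exists hT sab ba1.
have {pc} [acn cbn] : (a < c)%N /\ (c < b)%N.
  by move: pc; rewrite pab /pos; have := ltn_ord b; case: (leqP a c); lia.
have xab : x [set a; b] != 0 by have /segP[i <-] := sab.
pose al := x [set c; b] / x [set a; b]; pose be := x [set a; c] / x [set a; b].
pose vc := (al * va.1 + be * vb.1, al * va.2 + be * vb.2).
have dac : det2 va vc = x [set a; c].
  have -> : det2 va vc = be * det2 va vb by rewrite /det2 /vc /=; ring.
  by rewrite eab divfK.
have dcb : det2 vc vb = x [set c; b].
  have -> : det2 vc vb = al * det2 va vb by rewrite /det2 /vc /=; ring.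
  by rewrite eab divfK.
have [|v1 [v1a v1c v1P]] := IH a c va vc _ acn ac dac; first by lia.
have [|v2 [v2c v2b v2P]] := IH c b vc vb _ cbn cb dcb; first by lia.
exists (fun w : V => if (w <= c)%N then v1 w else v2 w); split.
- by rewrite ltnW.
- by rewrite leqNgt cbn.
move=> i j ai ij jb sij; have [jc|cj] := leqP j c.
  by rewrite (leq_trans (ltnW ij) jc) v1P.
have [ic|ci] := leqP i c; last by rewrite v2P // ltnW.
have [ec|nec] := eqVneq i c.
  by subst i; rewrite v1c -v2c v2P.
have {nec} ic' : (i < c)%N by rewrite ltn_neqAle nec.
have pa (w : V) : (a <= w)%N -> pos a w = (w - a)%N by rewrite /pos => ->.
have := seg_noncrossing hT ac sij; have := seg_noncrossing hT cb sij.
rewrite !(@crosses_pos _ a) ?pos_self ?pa /separates; try lia.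
move=> h1 h2.
have -> : i = a by apply: val_inj => /=; lia.
have -> : j = b by apply: val_inj => /=; lia.
by rewrite v1a v2b.
Qed.

(* Prescribing the determinants of the sides of T makes the Ptolemy relations
   instances of the Pluecker relation. *)
Lemma seg_vectors : exists v : V -> F * F, forall a b, (a < b)%N -> seg T a b ->
  det2 (v a) (v b) = x [set a; b].
Proof.
have s0 : seg T ord0 ord_max.
  have : ordS (@ord_max n.+2) = ord0 by apply: val_inj; rewrite /= modnn.
  by move=> <-; rewrite segC; apply: seg_ordS.
(* Any pair of vectors with the right determinant on the side joining the last vertex to the first
   could start the recursion. *)
have e0 : det2 (1, 0) (0, x [set ord0; ord_max]) = x [set ord0; ord_max].
  by rewrite /det2 /= mul1r mul0r subr0.
have lt0 : (@ord0 n.+2 < @ord_max n.+2)%N by [].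
have [v [_ _ vP]] := seg_vectors_between (leq_subr _ _) lt0 s0 e0.
exists v => a b ab; apply: vP => //=; by have := ltn_ord b; lia.
Qed.

Lemma lambda_lengths : exists lam : V -> V -> F,
  [/\ forall a b, lam a b = lam b a,
      forall a b, seg T a b -> lam a b = x [set a; b]
    & forall a b c d, ccw a b c -> ccw a c d ->
        lam a c * lam b d = lam a b * lam c d + lam a d * lam b c].
Proof.
have [v vP] := seg_vectors.
(* Taking the determinant in increasing order of vertices removes its sign and makes [lam]
   symmetric. *)
exists (fun a b => if (a < b)%N then det2 (v a) (v b) else det2 (v b) (v a)).
split=> [a b|a b sab|a b c d].
- by case: ltngtP => // /val_inj->.
- have := seg_neq hT sab; rewrite -(inj_eq val_inj) /=.
  case: ltngtP => // ab _; first exact: vP.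
  by rewrite finset.setUC; apply: vP => //; rewrite segC.
rewrite /ccw => h1 h2.
have {h1 h2}[h|h|h|h] : [\/ (a < b) && (b < c) && (c < d), (b < c) && (c < d) && (d < a),
   (c < d) && (d < a) && (a < b) | (d < a) && (a < b) && (b < c)]%N.
  move: h1 h2; have [|] := ltnP a b; have [|] := ltnP b c; have [|] := ltnP c d;
  have [|] := ltnP d a => ? ? ? ? ? ?; try (by constructor 1); try (by constructor 2);
  try (by constructor 3); try (by constructor 4); lia.
all: move: h => /andP[/andP[h1 h2] h3].
all: have h12 := ltn_trans h1 h2; have h23 := ltn_trans h2 h3; have h13 := ltn_trans h12 h3.
all: have lt_gtF (p q : V) : (p < q)%N -> (q < p)%N = false by lia.
all: have /lt_gtF f1 := h1; have /lt_gtF f2 := h2; have /lt_gtF f3 := h3.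
all: have /lt_gtF f12 := h12; have /lt_gtF f23 := h23; have /lt_gtF f13 := h13.
all: rewrite ?h1 ?h2 ?h3 ?h12 ?h23 ?h13 ?f1 ?f2 ?f3 ?f12 ?f23 ?f13 /det2; ring.
Qed.

End LambdaLengths.

(** * The diagonals crossed by st *)

Section Crossed.
Variables (n : nat) (T : labelling n) (s t : 'I_n.+3).
Notation V := 'I_n.+3.
Hypothesis hT : triangulation T.
Hypothesis st_neq : s != t.
Notation d := (size (crossed T s t)).
Notation tile := (tile_diagonal T s t).
Notation p := (pos s).
Implicit Types (a b c r l u v w : V).

Lemma pt_gt0 : 0 < p t.
Proof. by rewrite pos_neq0 eq_sym. Qed.

Lemma ccw_right v : ccw s v t = (0 < p v < p t).
Proof. by rewrite (ccw_pos s) pos_self; lia. Qed.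

Lemma ccw_left v : ccw t v s = (p t < p v).
Proof. by rewrite (ccw_pos s) pos_self; have := pt_gt0; lia. Qed.

Lemma crosses_st a b : crosses [set a; b] [set s; t] =
  (0 < p a < p t) && (p t < p b) || (0 < p b < p t) && (p t < p a).
Proof.
by rewrite crosses_setC (@crosses_pos _ s) ?pos_self ?pt_gt0 // /separates; lia.
Qed.

Lemma crossedP A : reflect
  (exists r l, [/\ A = [set r; l], seg T r l & [&& 0 < p r, p r < p t & p t < p l]])
  (A \in crossed T s t).
Proof.
rewrite mem_sort mem_filter; apply: (iffP andP) => [[cr /mapP[i _ eA]]|].
  have /cards2P[a [b [ab eab]]] : #|A| == 2 by rewrite eA card_label.
  have sab : seg T a b by rewrite /seg -eab eA codom_f.
  move: cr; rewrite eab crosses_st => /orP[]/andP[h1 h2].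
    by exists a, b; split=> //; lia.
  by exists b, a; split; rewrite 1?segC 1?finset.setUC //; lia.
move=> [r [l [-> rl /and3P[r0 rt tl]]]].
have cr : crosses [set r; l] [set s; t] by rewrite crosses_st r0 rt tl.
split=> //; have [i <-] := crosses_diagonal hT rl cr.
by apply: (map_f (fun i => T (lshift n.+3 i))); rewrite mem_enum.
Qed.

Lemma crossed_uniq : uniq (crossed T s t).
Proof.
rewrite sort_uniq filter_uniq // map_inj_uniq ?enum_uniq // => i j.
by case: hT => iT _ _ _ _ /iT/lshift_inj.
Qed.

Definition right_end k : V := odflt s [pick v in tile k | ccw s v t].
Definition left_end k : V := odflt s [pick v in tile k | ccw t v s].
Local Notation R := right_end.
Local Notation L := left_end.

Lemma crossed_right r l : [&& 0 < p r, p r < p t & p t < p l] ->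
  [set v in [set r; l] | ccw s v t] = [set r].
Proof.
move=> h; apply/setP => v; rewrite !inE ccw_right; apply/andP/eqP => [[]|->].
  by move=> /orP[]/eqP-> //; lia.
by rewrite eqxx; split=> //; lia.
Qed.

Lemma crossed_left r l : [&& 0 < p r, p r < p t & p t < p l] ->
  [set v in [set r; l] | ccw t v s] = [set l].
Proof.
move=> h; apply/setP => v; rewrite !inE ccw_left; apply/andP/eqP => [[]|->].
  by move=> /orP[]/eqP-> //; lia.
by rewrite eqxx orbT; split=> //; lia.
Qed.

Lemma tile_RL k r l : tile k = [set r; l] ->
  [&& 0 < p r, p r < p t & p t < p l] -> R k = r /\ L k = l.
Proof.
move=> e h; rewrite /right_end /left_end e; split.
  have: r \in [set v in [set r; l] | ccw s v t] by rewrite crossed_right // set11.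
  rewrite inE; case: pickP => [v|/(_ r) ->//] hv _ /=.
  by apply/set1P; rewrite -(crossed_right h) inE.
have: l \in [set v in [set r; l] | ccw t v s] by rewrite crossed_left // set11.
rewrite inE; case: pickP => [v|/(_ l) ->//] hv _ /=.
by apply/set1P; rewrite -(crossed_left h) inE.
Qed.

Lemma tileP k : k < d ->
  [/\ tile k = [set R k; L k], seg T (R k) (L k)
    & [&& 0 < p (R k), p (R k) < p t & p t < p (L k)]].
Proof.
move=> kd; have /crossedP[r [l [e rl h]]] : tile k \in crossed T s t by apply: mem_nth.
by have [-> ->] := tile_RL e h.
Qed.

Lemma tile_of r l : seg T r l -> [&& 0 < p r, p r < p t & p t < p l] ->
  exists k, [/\ k < d, R k = r & L k = l].
Proof.
move=> rl h; have : [set r; l] \in crossed T s t by apply/crossedP; exists r, l.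
move=> /(nthP finset.set0)[k kd e]; exists k.
by have [-> ->] := tile_RL e h.
Qed.

(** Seen from [s], a crossed diagonal cuts off an interval of positions around [t]; [crosses_before]
    is reverse inclusion of these intervals. *)
Lemma crosses_beforeE r l r' l' :
  [&& 0 < p r, p r < p t & p t < p l] ->
  [&& 0 < p r', p r' < p t & p t < p l'] ->
  crosses_before s [set r; l] [set r'; l'] = (p r <= p r') && (p l' <= p l).
Proof.
move=> h h'.
have bE v : (v \in [set r; l]) || crosses [set r; l] [set s; v] = (p r <= p v <= p l).
  rewrite !inE -!(pos_eq s) (@crosses_pos _ s) ?pos_self /separates; lia.
apply/forall_inP/idP => [hB|hh v].
  by have := hB r'; have := hB l'; rewrite set21 set22 !bE => /(_ isT) + /(_ isT); lia.
by rewrite bE !inE => /orP[]/eqP->; lia.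
Qed.

(** Crossed diagonals do not cross each other, so their intervals are nested; this gives totality of
    the sorting order, but only on crossed diagonals, hence the relativized sorting lemmas. *)
Lemma crossed_monotone i j : i <= j -> j < d -> p (R i) <= p (R j) /\ p (L j) <= p (L i).
Proof.
move=> ij jd; have id := leq_ltn_trans ij jd.
pose P := [pred A | A \in crossed T s t].
have tot : {in P &, total (crosses_before s)}.
  move=> A B /crossedP[r [l [-> rl h]]] /crossedP[r' [l' [-> rl' h']]].
  rewrite !crosses_beforeE //; have := seg_noncrossing hT rl rl'.
  by rewrite (@crosses_pos _ s) /separates; lia.
have srt : sorted (crosses_before s) (crossed T s t).
  rewrite /crossed; apply: (sort_sorted_in (P := P)) => //.
  by apply/allP => A; rewrite -(mem_sort (crosses_before s)).
have tr : {in P & &, transitive (crosses_before s)}.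
  move=> A B C /crossedP[r [l [-> rl h]]] /crossedP[r' [l' [-> rl' h']]].
  move=> /crossedP[r'' [l'' [-> rl'' h'']]].
  by rewrite !crosses_beforeE //; lia.
have rf : {in P, reflexive (crosses_before s)}.
  by move=> A /crossedP[r [l [-> rl h]]]; rewrite crosses_beforeE // !leqnn.
have allC : all P (crossed T s t) by apply/allP.
have := sorted_leq_nth_in tr rf finset.set0 allC srt i j id jd ij; rewrite -!/(tile _).
have [-> _ hi] := tileP id; have [-> _ hj] := tileP jd.
by rewrite crosses_beforeE // => /andP[].
Qed.

Lemma tile_inj i j : i < d -> j < d -> R i = R j -> L i = L j -> i = j.
Proof.
move=> id jd eR eL; have [ei _ _] := tileP id; have [ej _ _] := tileP jd.
apply/eqP; rewrite -(nth_uniq finset.set0 id jd crossed_uniq); apply/eqP.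
by rewrite -/(tile i) -/(tile j) ei ej eR eL.
Qed.

Lemma apex_inside u v : seg T u v -> (p u).+1 < p v ->
  exists c, [/\ p u < p c < p v, seg T u c & seg T c v].
Proof.
move=> uv puv; have h : 1 < pos u v.
  by move: puv; rewrite /pos; have := ltn_ord u; have := ltn_ord v;
     case: (leqP s u); case: (leqP s v); case: (leqP u v); lia.
have [c [pc uc cv]] := apex_exists hT uv h; exists c; split=> //.
have : ccw u c v by rewrite (ccw_pos u) pos_self pc.
by rewrite (ccw_pos s); lia.
Qed.

Lemma apex_outside u v : seg T u v -> 0 < p u < p v ->
  exists c, [/\ (p c < p u) || (p v < p c), seg T u c & seg T c v].
Proof.
move=> uv puv; have h : 1 < pos v u.
  move: puv; rewrite /pos; have := ltn_ord u; have := ltn_ord v; have := ltn_ord s.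
  by case: (leqP s u); case: (leqP s v); case: (leqP v u); lia.
rewrite segC in uv; have [c [pc vc cu]] := apex_exists hT uv h; exists c.
split; [|by rewrite segC|by rewrite segC].
have : ccw v c u by rewrite (ccw_pos v) pos_self pc.
by rewrite (ccw_pos s); lia.
Qed.

Definition moves_left k : bool := R k.+1 == R k.
(** The vertex opposite to the diagonal of tile [k] on the side of [t]: the endpoint of the next
    diagonal not shared with this one, and [t] itself after the last tile. [source_apex] plays the
    same part on the side of [s]. *)
Definition target_apex k : V :=
  if k.+1 < d then if moves_left k then L k.+1 else R k.+1 else t.
Definition source_apex k : V :=
  if k is j.+1 then if moves_left j then L j else R j else s.
Local Notation A := source_apex.
Local Notation B := target_apex.

(** Let [c] be the apex beyond the diagonal. If [c] is not [t], one of its two segments is again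
    crossed, say as tile [j]. Monotonicity squeezes tile [k.+1] between tiles [k] and [j], and
    noncrossing with the other segment makes it equal to tile [j]. If [c] is [t], no diagonal can
    follow. *)
Lemma next_tile k : k < d ->
  [/\ p (R k) < p (B k) < p (L k), seg T (R k) (B k), seg T (B k) (L k)
    & k.+1 < d -> if moves_left k then p (L k.+1) < p (L k)
        else (p (R k) < p (R k.+1)) && (L k.+1 == L k)].
Proof.
move=> kd; have [_ rl h] := tileP kd.
have [|c [pc rc cl]] := apex_inside rl; first by lia.
have [tc|ct|tc] := ltngtP (p c) (p t).
- have [|j [jd eRj eLj]] := tile_of cl; first by lia.
  have kj : k < j.
    by rewrite ltnNge; apply/negP => /crossed_monotone/(_ kd)[]; rewrite eRj; lia.
  have kd1 := leq_ltn_trans kj jd; have [_ rl1 h1] := tileP kd1.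
  have [m1 m2] := crossed_monotone (leqnSn k) kd1; have [m3 m4] := crossed_monotone kj jd.
  rewrite eRj eLj in m3 m4.
  have eL : L k.+1 = L k by apply: (@pos_inj _ s); lia.
  have eR : R k.+1 = c.
    apply: (@pos_inj _ s); have neR : p (R k) <> p (R k.+1).
      by move=> /pos_inj eR; have := tile_inj kd kd1 eR (esym eL); lia.
    by have := seg_noncrossing hT rc rl1; rewrite (@crosses_pos _ s) /separates; lia.
  have nmv : moves_left k = false.
    by apply/negP => /eqP e; move: pc; rewrite -eR e; lia.
  by rewrite /target_apex kd1 nmv eR eL eqxx; split=> // _; lia.
- have [|j [jd eRj eLj]] := tile_of rc; first by lia.
  have kj : k < j.
    by rewrite ltnNge; apply/negP => /crossed_monotone/(_ kd)[]; rewrite eLj; lia.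
  have kd1 := leq_ltn_trans kj jd; have [_ rl1 h1] := tileP kd1.
  have [m1 m2] := crossed_monotone (leqnSn k) kd1; have [m3 m4] := crossed_monotone kj jd.
  rewrite eRj eLj in m3 m4.
  have eR : R k.+1 = R k by apply: (@pos_inj _ s); lia.
  have eL : L k.+1 = c.
    apply: (@pos_inj _ s); have neL : p (L k) <> p (L k.+1).
      by move=> /pos_inj eL; have := tile_inj kd kd1 (esym eR) eL; lia.
    by have := seg_noncrossing hT cl rl1; rewrite (@crosses_pos _ s) /separates; lia.
  have mv : moves_left k by apply/eqP.
  by rewrite /target_apex kd1 mv eL; split=> // _; lia.
move: tc => /pos_inj ec; subst c.
have kd1 : (k.+1 < d) = false.
  apply/negP => kd1; have [_ rl1 h1] := tileP kd1.
  have [m1 m2] := crossed_monotone (leqnSn k) kd1.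
  have := seg_noncrossing hT cl rl1; have := seg_noncrossing hT rc rl1.
  rewrite !(@crosses_pos _ s) /separates; try lia.
  move=> h2 h3; have eR : R k = R k.+1 by apply: (@pos_inj _ s); lia.
  have eL : L k = L k.+1 by apply: (@pos_inj _ s); lia.
  by have := tile_inj kd kd1 eR eL; lia.
by rewrite /target_apex kd1.
Qed.

(** For the first tile, an apex other than [s] would give a crossed diagonal preceding it; later
    tiles inherit the triangle from [next_tile]. *)
Lemma prev_tile k : k < d ->
  [/\ (p (A k) < p (R k)) || (p (L k) < p (A k)), seg T (R k) (A k) & seg T (A k) (L k)].
Proof.
case: k => [|k] kd /=.
  have [_ rl h] := tileP kd.
  have [|c [pc rc cl]] := apex_outside rl; first by lia.
  have [ec|nec] := eqVneq c s; first by subst c.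
  have {nec} c0 : 0 < p c by rewrite pos_neq0.
  case/orP: pc => pc.
    have [|j [jd eRj eLj]] := tile_of cl; first by lia.
    by have [] := crossed_monotone (leq0n j) jd; rewrite eRj; lia.
  have [|j [jd eRj eLj]] := tile_of rc; first by lia.
  by have [] := crossed_monotone (leq0n j) jd; rewrite eLj; lia.
have kd' := ltnW kd; have [_ rl h] := tileP kd'; have [_ rl1 h1] := tileP kd.
have [pB rB Bl] := next_tile kd'; rewrite kd => /(_ isT).
move: pB rB Bl; rewrite /target_apex kd; case: ifP => [/eqP eR|_] pB rB Bl.
  by rewrite eR => h2; split=> //; [lia|rewrite segC].
by move=> /andP[h2 /eqP eL]; rewrite eL; split=> //; [lia|rewrite segC].
Qed.

Lemma first_crossed : ~~ seg T s t -> 0 < d.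
Proof.
move=> /negP st_notin; case: (posnP d) => // d0; case: st_notin.
apply: seg_maximal => // a b ab; apply/negP; rewrite crosses_setC crosses_st => cr.
have [r [l [rl h]]] : exists r l, seg T r l /\ [&& 0 < p r, p r < p t & p t < p l].
  case/orP: cr => cr; [exists a, b|exists b, a]; split=> //; try lia.
  by rewrite segC.
by have [k []] := tile_of rl h; rewrite d0.
Qed.

End Crossed.

(** * Polygon vertices at the corners of tiles *)

Section SnakeLabels.
Variables (n : nat) (T : labelling n) (s t : 'I_n.+3).
Notation V := 'I_n.+3.
Hypothesis hT : triangulation T.
Hypothesis st_neq : s != t.
Notation d := (size (crossed T s t)).
Notation tile := (tile_diagonal T s t).
Notation p := (pos s).
Notation R := (right_end T s t).
Notation L := (left_end T s t).
Notation A := (source_apex T s t).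
Notation B := (target_apex T s t).
Notation gn := (glue_north T s t).
Notation moves_left := (moves_left T s t).
Notation side := (side_segment T s t).

Definition SEv k : V := if odd k then L k else R k.
Definition NWv k : V := if odd k then R k else L k.

Lemma tile_quad k : k < d -> quad T (tile k) (R k) (L k) (B k) (A k).
Proof.
move=> kd; have [eT rl h] := tileP hT st_neq kd.
have [pB rB Bl _] := next_tile hT st_neq kd; have [pA rA Al] := prev_tile hT st_neq kd.
split=> //; rewrite ?rB ?Bl //; last by rewrite segC Al segC rA.
by rewrite !(ccw_pos s); move: h pB pA; clear; lia.
Qed.

Lemma tile_apices k : k < d -> apices T (tile k) = [set B k; A k].
Proof.
move=> kd; apply: (quad_apices hT) (tile_quad kd).
by have [-> rl _] := tileP hT st_neq kd.
Qed.

Lemma cornerE k : k < d ->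
  (corner T s t k SW = [set A k]) * (corner T s t k NE = [set B k]) *
  (corner T s t k SE = [set SEv k]) * (corner T s t k NW = [set NWv k]).
Proof.
move=> kd; have [eT rl h] := tileP hT st_neq kd; have eA := tile_apices kd.
have [pB _ _ _] := next_tile hT st_neq kd; have [pA _ _] := prev_tile hT st_neq kd.
have crE u v : crosses (tile k) [set u; v] = separates (p (R k)) (p (L k)) (p u) (p v).
  by rewrite eT (@crosses_pos _ s) //; lia.
rewrite /corner /= eA; do !split.
- apply/setP => v; rewrite !inE crE pos_self /separates.
  apply/andP/eqP => [[/orP[]/eqP-> //]|->]; first by lia.
  by rewrite eqxx orbT; split=> //; lia.
- apply/setP => v; rewrite !inE crE /separates.
  apply/andP/eqP => [[/orP[]/eqP-> //]|->]; first by lia.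
  by rewrite eqxx; split=> //; lia.
- rewrite eT /SEv; case: (odd k); rewrite ?(crossed_left st_neq h) //.
  exact: crossed_right.
- rewrite eT /NWv; case: (odd k); rewrite ?(crossed_left st_neq h) //.
  exact: crossed_right.
Qed.

Lemma sideE k : k < d ->
  (side k south = [set A k; SEv k]) * (side k north = [set NWv k; B k]) *
  (side k west = [set A k; NWv k]) * (side k east = [set SEv k; B k]).
Proof.
move=> kd; rewrite /side_segment /side_corners /=.
by rewrite !big_cons !big_nil !finset.setU0 !(cornerE kd).
Qed.

Lemma SE_NW k : [set SEv k; NWv k] = [set R k; L k].
Proof. by rewrite /SEv /NWv; case: (odd k) => //; rewrite finset.setUC. Qed.

Lemma third_sideE k : k.+1 < d -> third_side T s t k =
  if moves_left k then [set L k; B k] else [set R k; B k].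
Proof.
move=> kd; have kd' := ltnW kd; have [eT rl h] := tileP hT st_neq kd'.
have [eT1 rl1 h1] := tileP hT st_neq kd; have [pB _ _] := next_tile hT st_neq kd'.
rewrite kd => /(_ isT); rewrite /third_side eT eT1 /target_apex kd.
case: ifP => [/eqP eR|_] h2.
  apply/setP => v; rewrite !inE eR.
  have [->|v1] := eqVneq v (R k).
    by rewrite -!(pos_eq s); lia.
  have [->|v2] := eqVneq v (L k); first by rewrite -!(pos_eq s); lia.
  by rewrite /= ?andbF ?orbF ?andbT.
case/andP: h2 => h2 /eqP eL; apply/setP => v; rewrite !inE eL.
have [->|v1] := eqVneq v (L k); first by rewrite -!(pos_eq s); lia.
have [->|v2] := eqVneq v (R k); first by rewrite -!(pos_eq s); lia.
by rewrite /= ?andbF ?orbF ?andbT.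
Qed.

(** The third side joins [B k] to the end of the diagonal that is about to move, the north side
    joins it to [NWv k], and [NWv k] is the left end exactly for even [k]. *)
Lemma glue_northE k : k.+1 < d -> gn k = moves_left k (+) odd k.
Proof.
move=> kd; have kd' := ltnW kd; have [eT rl h] := tileP hT st_neq kd'.
have [pB _ _ _] := next_tile hT st_neq kd'.
rewrite /glue_north (sideE kd') third_sideE // /NWv.
have neq : [set R k; B k] != [set L k; B k].
  by apply/eqP => /set2_eq[] [/eqP + /eqP]; rewrite -!(pos_eq s); lia.
by case: (moves_left k); case: (odd k) => /=; rewrite ?eqxx ?(negPf neq) // eq_sym (negPf neq).
Qed.

(** Two of the equations say that the corners identified in the plane carry the same polygon vertex.
    The remaining one concerns distinct corners: the endpoint common to both diagonals appears at
    opposite corners of the two tiles taken together. *)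
Lemma glue_corners k : k.+1 < d ->
  if gn k then [/\ SEv k.+1 = B k, NWv k.+1 = SEv k & A k.+1 = NWv k]
  else [/\ NWv k.+1 = B k, SEv k.+1 = NWv k & A k.+1 = SEv k].
Proof.
move=> kd; rewrite glue_northE // /SEv /NWv /target_apex kd /=.
have [_ _ _] := next_tile hT st_neq (ltnW kd); rewrite kd => /(_ isT).
case mv: (moves_left k); case: (odd k) => //= h; first by split=> //; apply/eqP.
- by split=> //; apply/eqP.
- by case/andP: h => _ /eqP.
- by case/andP: h => _ /eqP.
Qed.

Lemma side_seg k e : k < d -> side k e \in codom T.
Proof.
move=> kd; have [eT rl h] := tileP hT st_neq kd; have sE := sideE kd.
have [_ rB Bl _] := next_tile hT st_neq kd; have [_ rA Al] := prev_tile hT st_neq kd.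
have [BR BL] : seg T (B k) (R k) /\ seg T (L k) (B k) by rewrite segC rB segC Bl.
have [AR LA] : seg T (A k) (R k) /\ seg T (L k) (A k) by rewrite segC rA segC Al.
case: e => -[] []; rewrite -/north -/south -/west -/east sE /SEv /NWv;
  by case: (odd k).
Qed.

End SnakeLabels.

(** * Labels occurring once *)

Section UniqueLabels.
Variables (n : nat) (T : labelling n) (s t : 'I_n.+3).
Notation V := 'I_n.+3.
Hypothesis hT : triangulation T.
Hypothesis st_neq : s != t.
Notation d := (size (crossed T s t)).
Notation p := (pos s).
Notation R := (right_end T s t).
Notation L := (left_end T s t).
Notation A := (source_apex T s t).
Notation B := (target_apex T s t).
Notation SEv := (SEv T s t).
Notation NWv := (NWv T s t).
Notation gn := (glue_north T s t).
Notation moves_left := (moves_left T s t).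
Notation side := (side_segment T s t).

Definition glue_label k : {set V} :=
  if moves_left k then [set L k; L k.+1] else [set R k; R k.+1].

Definition glue_side k := if gn k then north else east.

Lemma glue_labelE k : k.+1 < d -> side k (glue_side k) = glue_label k.
Proof.
move=> kd; rewrite /glue_side /glue_label glue_northE //.
have sE := sideE hT st_neq (ltnW kd).
have := glue_corners hT st_neq kd; rewrite glue_northE // => h.
have eB : B k = if moves_left k then L k.+1 else R k.+1 by rewrite /target_apex kd.
by case: (moves_left k) eB; case o: (odd k) => /= eB; rewrite sE /SEv /NWv o eB // finset.setUC.
Qed.

Lemma glue_label_crosses k : k.+1 < d ->
  [/\ ~~ crosses (glue_label k) [set s; t], s \notin glue_label k & t \notin glue_label k].
Proof.
move=> kd; have [_ _ h] := tileP hT st_neq (ltnW kd).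
have [_ _ h1] := tileP hT st_neq kd.
by rewrite /glue_label; case: ifP => _; 
  rewrite crosses_st // !inE -!(pos_eq s) pos_self; split; lia.
Qed.

(** Labels on opposite sides of [st] share no vertex, and on one side the moving end never
    returns. *)
Lemma glue_label_neq j k : j < k -> k.+1 < d -> glue_label j != glue_label k.
Proof.
move=> jk kd; have kd' := ltnW kd; have jd := ltn_trans jk kd'.
have jd1 := leq_ltn_trans jk kd'.
have [_ _ h1] := tileP hT st_neq jd; have [_ _ h2] := tileP hT st_neq jd1.
have [_ _ h3] := tileP hT st_neq kd'; have [_ _ h4] := tileP hT st_neq kd.
have [_ _ _ /(_ jd1) mj] := next_tile hT st_neq jd.
have [_ _ _ /(_ kd) mk] := next_tile hT st_neq kd'.
have [m1 m2] := crossed_monotone hT st_neq jk kd'.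
rewrite /glue_label; case: (moves_left j) mj; case: (moves_left k) mk => mk mj;
  by apply/eqP => /set2_eq[] [/eqP + /eqP]; rewrite -!(pos_eq s); lia.
Qed.

Lemma glue_label_inj j k : j.+1 < d -> k.+1 < d -> glue_label j = glue_label k -> j = k.
Proof.
move=> jd kd e; have [jk|kj|//] := ltngtP j k.
  by have := glue_label_neq jk kd; rewrite e eqxx.
by have := glue_label_neq kj jd; rewrite e eqxx.
Qed.

Lemma RL_crosses k : k < d -> crosses [set R k; L k] [set s; t].
Proof. by move=> kd; have [_ _ h] := tileP hT st_neq kd; rewrite crosses_st //; lia. Qed.

(** Every edge that is not glued is labelled by a crossed diagonal or by a segment ending at [s] or
    [t], and by [glue_label_crosses] a glue label is none of these. Hence a glue label can only
    recur on a glued edge. *)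
Lemma side_cases k e : k < d -> ~~ duplicate_side T s t k e ->
  [\/ k.+1 < d /\ e = glue_side k, crosses (side k e) [set s; t],
      k = 0 /\ (e = south \/ e = west) | t \in side k e].
Proof.
move=> kd; have sE := sideE hT st_neq kd.
have [kd1|kd1] := boolP (k.+1 < d).
  have := glue_corners hT st_neq kd1; have := RL_crosses kd1; rewrite -SE_NW /glue_side.
  case: e => -[] []; rewrite -/north -/south -/west -/east.
  - case: (gn k) => cr [h1 h2 h3]; first by constructor 1.
    by constructor 2; rewrite sE -h1 -h2.
  - case: k kd sE kd1 => [|k] kd sE kd1; first by constructor 3; split=> //; left.
    rewrite /duplicate_side /=; have := glue_corners hT st_neq kd.
    case gnk: (gn k) => // -[h1 h2 h3] _ _ _; constructor 2.
    by rewrite sE h2 h3 SE_NW RL_crosses // ltnW.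
  - case: (gn k) => cr [h1 h2 h3]; last by constructor 1.
    by constructor 2; rewrite sE -h1 -h2 finset.setUC.
  - case: k kd sE kd1 => [|k] kd sE kd1; first by constructor 3; split=> //; right.
    rewrite /duplicate_side /=; have := glue_corners hT st_neq kd.
    case gnk: (gn k) => // -[h1 h2 h3] _ _ _; constructor 2.
    by rewrite sE h2 h3 finset.setUC SE_NW RL_crosses // ltnW.
have eB : B k = t by rewrite /target_apex (negPf kd1).
case: e => -[] []; rewrite -/north -/south -/west -/east.
- by constructor 4; rewrite sE eB set22.
- case: k kd sE kd1 eB => [|k] kd sE kd1 eB; first by constructor 3; split=> //; left.
  rewrite /duplicate_side /=; have := glue_corners hT st_neq kd.
  case gnk: (gn k) => // -[h1 h2 h3] _; constructor 2.
  by rewrite sE h2 h3 SE_NW RL_crosses // ltnW.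
- by constructor 4; rewrite sE eB set22.
- case: k kd sE kd1 eB => [|k] kd sE kd1 eB; first by constructor 3; split=> //; right.
  rewrite /duplicate_side /=; have := glue_corners hT st_neq kd.
  case gnk: (gn k) => // -[h1 h2 h3] _; constructor 2.
  by rewrite sE h2 h3 finset.setUC SE_NW RL_crosses // ltnW.
Qed.

Lemma first_sides : 0 < d -> side 0 south = [set s; R 0] /\ side 0 west = [set s; L 0].
Proof. by move=> d0; rewrite !(sideE hT st_neq d0). Qed.

Lemma unique_glue_label k : k.+1 < d -> unique_label T s t k (glue_side k).
Proof.
move=> kd; have [_ /codomP[i]] : True /\ side k (glue_side k) \in codom T.
  by split=> //; apply: side_seg (ltnW kd).
rewrite glue_labelE // => ei; exists i => -[[j jd] e]; rewrite inE /= => nd.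
have [ncr sN tN] := glue_label_crosses kd; rewrite -ei.
apply/eqP/eqP => [eg|[-> ->]]; last exact: glue_labelE.
have [[jd1 ee]|cr|[j0 ee]|tS] := side_cases jd nd.
- rewrite ee glue_labelE // in eg.
  by rewrite (glue_label_inj jd1 kd eg) ee (glue_label_inj jd1 kd eg).
- by rewrite eg (negPf ncr) in cr.
- subst j; have [e1 e2] := first_sides jd.
  by move: sN; rewrite -eg; case: ee => ->; rewrite ?e1 ?e2 set21.
- by rewrite eg (negPf tN) in tS.
Qed.

(** This label is the segment from [s] to [R 0]: glue labels avoid [s], crossed diagonals do not end
    at [s], the west side leads to [L 0], and [R 0] is not [t]. *)
Lemma unique_first_label : 0 < d -> unique_label T s t 0 south.
Proof.
move=> d0; have [_ /codomP[i ei]] : True /\ side 0 south \in codom T.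
  by split=> //; apply: side_seg d0.
exists i => -[[j jd] e]; rewrite inE /= => nd; rewrite -ei.
apply/eqP/eqP => [eg|[-> ->]//].
have [e1 e2] := first_sides d0; have [_ _ h] := tileP hT st_neq d0.
rewrite e1 in eg; have [[jd1 ee]|cr|[j0 ee]|tS] := side_cases jd nd.
- have [_ + _] := glue_label_crosses jd1; rewrite -glue_labelE // -ee eg.
  by rewrite set21.
- by move: cr; rewrite eg crosses_st // pos_self; lia.
- subst j; case: ee => ee; rewrite ee // in eg *.
  move: eg; rewrite e2 => /set2_eq[] [/eqP + /eqP]; rewrite -!(pos_eq s) ?pos_self; lia.
- by move: tS; rewrite eg !inE -!(pos_eq s) pos_self; lia.
Qed.

End UniqueLabels.

(** * The expansion formula *)

Section PositiveSupport.
Variable N : nat.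
Local Open Scope ring_scope.

(** Nonnegativity is carried along because it makes the support of a sum the union of the
    supports. *)
Definition positive_support (p : {mpoly rat[N]}) (S : 'X_{1..N} -> Prop) : Prop :=
  (forall m, 0 <= p@_m) /\ forall m, m \in msupp p <-> S m.

Lemma eq_positive_support p (S S' : 'X_{1..N} -> Prop) :
  (forall m, S m <-> S' m) -> positive_support p S -> positive_support p S'.
Proof. by move=> SS' [p0 pS]; split=> // m; rewrite pS SS'. Qed.

Lemma positive_support0 : positive_support 0 (fun=> False).
Proof. by split=> m; rewrite ?mcoeff0 // mcoeff_msupp mcoeff0 eqxx. Qed.

Lemma positive_supportX e : positive_support 'X_[e] (fun m => m = e).
Proof.
split=> m; first by rewrite mcoeffX ler0n.
by rewrite msuppX inE; split=> [/eqP|->].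
Qed.

Lemma positive_supportD p q S S' : positive_support p S -> positive_support q S' ->
  positive_support (p + q) (fun m => S m \/ S' m).
Proof.
move=> [p0 pS] [q0 qS]; split=> m; first by rewrite mcoeffD addr_ge0.
rewrite -pS -qS !mcoeff_msupp mcoeffD paddr_eq0 // negb_and.
by split=> [/orP|/orP].
Qed.

Lemma positive_supportMX p S e : positive_support p S ->
  positive_support (p * 'X_[e]) (fun m => exists2 m', S m' & m = (m' + e)%MM).
Proof.
move=> [p0 pS].
have supp m : m \in msupp (p * 'X_[e]) <-> exists2 m', m' \in msupp p & m = (m' + e)%MM.
  rewrite (perm_mem (msuppMX p e)); split=> [/mapP[m' m'p ->]|[m' m'p ->]].
    by exists m'; rewrite // addmC.
  by rewrite addmC map_f.
split=> m; last by rewrite supp; split=> -[m' /pS]; exists m'.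
have [/supp[m' _ ->]|] := boolP (m \in msupp (p * 'X_[e])).
  by rewrite addmC mcoeffMX.
by rewrite -mcoeff_eq0 => /eqP->.
Qed.

End PositiveSupport.

Section Expansion.
Variables (n : nat) (T : labelling n) (s t : 'I_n.+3).
Notation V := 'I_n.+3.
Notation N := (n + n.+3).
Hypothesis hT : triangulation T.
Hypothesis st_neq : s != t.
Notation d := (size (crossed T s t)).
Notation p := (pos s).
Notation R := (right_end T s t).
Notation L := (left_end T s t).
Notation A := (source_apex T s t).
Notation B := (target_apex T s t).
Notation SEv := (SEv T s t).
Notation NWv := (NWv T s t).
Notation gn := (glue_north T s t).
Notation side := (side_segment T s t).
Notation tile := (tile_diagonal T s t).
Notation in_state := (in_state T s t).
Notation allowed := (allowed T s t).
Local Open Scope ring_scope.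

Definition label_index (A : {set V}) : 'I_N := odflt (rshift n ord0) [pick i | T i == A].

Lemma label_indexK A : A \in codom T -> T (label_index A) = A.
Proof.
move=> /codomP[i ->]; rewrite /label_index; case: pickP => [j /eqP//|/(_ i)].
by rewrite eqxx.
Qed.

Lemma label_index_label i : label_index (T i) = i.
Proof. by case: hT => iT _ _ _ _; apply: iT; rewrite label_indexK // codom_f. Qed.

Definition seg_var (A : {set V}) : ambient N := tofrac 'X_(label_index A).

Variable lam : V -> V -> ambient N.
Hypothesis lamC : forall a b, lam a b = lam b a.
Hypothesis lam_seg : forall a b, seg T a b -> lam a b = seg_var [set a; b].
Hypothesis lam_ptolemy : forall a b c d, ccw a b c -> ccw a c d ->
  lam a c * lam b d = lam a b * lam c d + lam a d * lam b c.

Definition lab k e : 'X_{1..N} := U_(label_index (side k e))%MM.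

Definition in_exp g k : 'X_{1..N} :=
  ((if ~~ duplicate_side T s t k south && in_state g (k, south) then lab k south else 0) +
   (if ~~ duplicate_side T s t k west && in_state g (k, west) then lab k west else 0))%MM.
Definition out_exp g k : 'X_{1..N} :=
  ((if in_state g (k, north) then lab k north else 0) +
   (if in_state g (k, east) then lab k east else 0))%MM.
(** The exponent of the partial matching formed by the edges before the northeast half of tile
    [k]. *)
Definition pre_exp g k : 'X_{1..N} :=
  (\sum_(j < k) (in_exp g j + out_exp g j) + in_exp g k)%MM.

Definition allowed_upto k (g : nat -> bool) : Prop := forall j, (j < k)%N ->
  if gn j then g j || g j.+1 else ~~ (g j && g j.+1).

Definition transition k (b b' : bool) : bool :=
  if gn k then b || b' else ~~ (b && b').
(** Passing from one tile to the next adds exactly one edge to the partial matching. The value at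
    the forbidden pair of bits is arbitrary. *)
Definition transition_edge k (b b' : bool) : nat * (bool * bool) :=
  if gn k then if b then if b' then (k, north) else (k.+1, west) else (k, east)
  else if b then (k, north) else if b' then (k.+1, south) else (k, east).
Definition transition_exp k b b' : 'X_{1..N} :=
  lab (transition_edge k b b').1 (transition_edge k b b').2.

Lemma pre_expS g k : pre_exp g k.+1 = (pre_exp g k + (out_exp g k + in_exp g k.+1))%MM.
Proof. by rewrite /pre_exp big_ord_recr /= !addmA. Qed.

Lemma eq_pre_exp g g' k : (k < d)%N -> (forall j, (j <= k)%N -> g j = g' j) ->
  pre_exp g k = pre_exp g' k.
Proof.
move=> kd gg'; have in_eq j : (j <= k)%N -> in_exp g j = in_exp g' j.
  by move=> jk; rewrite /in_exp /in_state /= gg'.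
rewrite /pre_exp in_eq //; congr (_ + _)%MM; apply: eq_bigr => -[j jk] _ /=.
rewrite in_eq 1?ltnW //; congr (_ + _)%MM.
by rewrite /out_exp /in_state /= (gg' j (ltnW jk)) (gg' j.+1 jk).
Qed.

Lemma transition_expE g k : (k.+1 < d)%N -> allowed_upto k.+1 g ->
  (out_exp g k + in_exp g k.+1)%MM = transition_exp k (g k) (g k.+1).
Proof.
move=> kd /(_ k (ltnSn k)).
rewrite /out_exp /in_exp /transition_exp /transition_edge /in_state /duplicate_side /= kd.
by case: (gn k); case: (g k); case: (g k.+1) => //= _; rewrite ?(addm0, add0m).
Qed.

Definition state_vertex k (b : bool) : V := if b then SEv k else NWv k.

Definition pre_monomials k b (m : 'X_{1..N}) : Prop :=
  exists g, [/\ allowed_upto k g, g k = b & m = pre_exp g k].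

Lemma pre_monomialsS k b' m : (k.+1 < d)%N -> pre_monomials k.+1 b' m <->
  exists b, transition k b b' /\
    exists2 m', pre_monomials k b m' & m = (m' + transition_exp k b b')%MM.
Proof.
move=> kd; split=> [[g [ag <- ->]]|[b [tr [m' [g [ag gk ->]] ->]]]].
  exists (g k); split; first exact: ag.
  exists (pre_exp g k); last by rewrite pre_expS transition_expE.
  by exists g; split=> // j jk; apply: ag; apply: ltnW.
pose g' j := if (j <= k)%N then g j else b'.
have g'E j : (j <= k)%N -> g j = g' j by rewrite /g' => ->.
have g'k : g' k.+1 = b' by rewrite /g' ltnn.
have ag' : allowed_upto k.+1 g'.
  move=> j; rewrite ltnS leq_eqVlt => /predU1P[->|jk].
    by rewrite g'k -g'E // gk.
  by rewrite -(g'E j (ltnW jk)) -(g'E j.+1 jk); apply: ag.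
exists g'; split=> //; rewrite pre_expS transition_expE // g'k -g'E // gk.
by rewrite (eq_pre_exp _ g'E) // ltnW.
Qed.

Lemma lam_tile k : (k < d)%N -> lam (SEv k) (NWv k) = seg_var (tile k).
Proof.
move=> kd; have [eT rl _] := tileP hT st_neq kd; rewrite eT.
by rewrite /SEv /NWv; case: (odd k); rewrite ?(lamC (L k)) lam_seg.
Qed.

Lemma lam_side k : (k < d)%N ->
  (lam (NWv k) (B k) = seg_var (side k north)) * (lam (SEv k) (B k) = seg_var (side k east)).
Proof.
move=> kd; rewrite !(sideE hT st_neq kd) -!lam_seg //.
  by have := side_seg hT st_neq east kd; rewrite (sideE hT st_neq kd).
by have := side_seg hT st_neq north kd; rewrite (sideE hT st_neq kd).
Qed.

(** Ptolemy for [s], [R k], [B k], [L k]. Using [s] instead of the source apex makes this a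
    recursion on lambda lengths of segments from [s], which need not belong to [T]. *)
Lemma lam_next k : (k < d)%N -> lam s (B k) * seg_var (tile k) =
  lam s (SEv k) * seg_var (side k north) + lam s (NWv k) * seg_var (side k east).
Proof.
move=> kd; rewrite -!lam_side // -lam_tile //.
have [_ _ h] := tileP hT st_neq kd; have [pB _ _ _] := next_tile hT st_neq kd.
have := @lam_ptolemy s (R k) (B k) (L k).
rewrite !(ccw_pos s) pos_self => pt.
have {}pt := pt _ _; rewrite /SEv /NWv; case: (odd k).
  rewrite (lamC (L k) (R k)) pt; try lia.
  by rewrite (lamC (B k)) addrC.
by rewrite pt; try lia; rewrite (lamC (B k)).
Qed.

(** The corner reached at tile [k.+1] may be [B k], where [lam_next] yields two terms. Otherwise it
    is an endpoint of both diagonals; the only transition then uses a side of tile [k.+1] labelled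
    by the diagonal of tile [k], and both members coincide. *)
Lemma lam_transition k b' : (k.+1 < d)%N ->
  lam s (state_vertex k.+1 b') * seg_var (tile k) =
  \sum_(b : bool | transition k b b') lam s (state_vertex k b) *
     tofrac 'X_[transition_exp k b b'].
Proof.
move=> kd; have kd' := ltnW kd; have gc := glue_corners hT st_neq kd.
have nx := lam_next kd'; have sE := sideE hT st_neq kd.
have eT : [set NWv k; SEv k] = tile k.
  by have [-> _ _] := tileP hT st_neq kd'; rewrite finset.setUC SE_NW.
rewrite big_mkcond big_bool /= /transition /transition_exp /transition_edge /lab.
case: (gn k) gc => -[h1 h2 h3]; case: b' => /=.
- by rewrite h1 nx.
- by rewrite addr0 h2 sE h2 h3 eT.
- by rewrite add0r h2 sE h2 h3 finset.setUC eT.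
- by rewrite h1 nx.
Qed.

(** The product of the earlier diagonals clears denominators and leaves the generating function of
    partial matchings with last bit [b], of which only positivity and support are kept. It starts
    with a variable, since [s] is the apex of a triangle of [T] on the first diagonal. *)
Lemma pre_expansion k b : (k < d)%N -> exists q : {mpoly rat[N]},
  positive_support q (pre_monomials k b) /\
  tofrac q = lam s (state_vertex k b) * \prod_(j < k) seg_var (tile j).
Proof.
elim: k b => [|k IH] b kd.
  have [e1 e2] := first_sides hT st_neq kd.
  have [_ rA Al] := prev_tile hT st_neq kd; rewrite segC /= in rA.
  exists 'X_[lab 0 (if b then south else west)]; split.
    apply: eq_positive_support (positive_supportX _) => m; split=> [->|].
      exists (fun=> b); split=> //; rewrite /pre_exp big_ord0 add0m /in_exp /in_state /=.
      by case: (b); rewrite ?addm0 ?add0m.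
    move=> [g [_ <- ->]]; rewrite /pre_exp big_ord0 add0m /in_exp /in_state /=.
    by case: (g 0); rewrite ?addm0 ?add0m.
  by rewrite big_ord0 mulr1 /lab /state_vertex; case: b; rewrite ?e1 ?e2 lam_seg.
have [qT [qTs qTe]] := IH true (ltnW kd); have [qF [qFs qFe]] := IH false (ltnW kd).
pose q c := if c then qT else qF.
pose f c := if transition k c b then q c * 'X_[transition_exp k c b] else 0.
have fs c : positive_support (f c) (fun m => transition k c b /\
    exists2 m', pre_monomials k c m' & m = (m' + transition_exp k c b)%MM).
  rewrite /f; case: ifP => _; last first.
    by apply: eq_positive_support (positive_support0 _) => m; split=> // -[].
  have : positive_support (q c) (pre_monomials k c) by case: c.
  by move=> /(positive_supportMX (transition_exp k c b)); apply: eq_positive_support => m;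
    split=> [|[]].
exists (f true + f false); split.
  apply: eq_positive_support (positive_supportD (fs true) (fs false)) => m.
  by rewrite pre_monomialsS //; split=> [[h|h]|[[] h]]; [exists true|exists false|left|right].
rewrite big_ord_recr /= [\prod_(j < k) _ * _]mulrC mulrA lam_transition //.
rewrite big_mkcond big_bool /= mulrDl tofracD /f; congr (_ + _).
  by case: ifP => _; rewrite ?tofrac0 ?mul0r // tofracM /q qTe mulrAC.
by case: ifP => _; rewrite ?tofrac0 ?mul0r // tofracM /q qFe mulrAC.
Qed.

Definition state_exp g : 'X_{1..N} := (\sum_(j < d) (in_exp g j + out_exp g j))%MM.
Definition denominator : 'X_{1..N} := (\sum_(j < d) U_(label_index (tile j)))%MM.

(** After the last tile the target apex is [t], so a final [lam_next] reaches [lam s t]; its two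
    terms complete the matching by the north or the east side. *)
Lemma state_expansion : (0 < d)%N -> exists q : {mpoly rat[N]},
  positive_support q (fun m => exists2 g, allowed g & m = state_exp g) /\
  lam s t * tofrac 'X_[denominator] = tofrac q.
Proof.
move=> d0; pose k := d.-1; have kd : d = k.+1 by rewrite /k prednK.
have kd' : (k < d)%N by rewrite kd.
have kd1 : (k.+1 < d)%N = false by rewrite kd ltnn.
have [qT [qTs qTe]] := pre_expansion true kd'.
have [qF [qFs qFe]] := pre_expansion false kd'.
exists (qT * 'X_[lab k north] + qF * 'X_[lab k east]); split.
  apply: eq_positive_support (positive_supportD (positive_supportMX _ qTs)
    (positive_supportMX _ qFs)) => m.
  have expE g : state_exp g =
      (pre_exp g k + if g k then lab k north else lab k east)%MM.
    rewrite /state_exp; transitivity (\sum_(j < k.+1) (in_exp g j + out_exp g j))%MM.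
      by rewrite -kd.
    have -> : (if g k then lab k north else lab k east) = out_exp g k.
      by rewrite /out_exp /in_state /= kd1 /=; case: (g k); rewrite ?addm0 ?add0m.
    by rewrite big_ord_recr /= /pre_exp addmA.
  have allE g : allowed g <-> allowed_upto k g.
    by split=> h j jk; apply: h; move: jk; rewrite kd ltnS.
  split=> [[] [m' [g [/allE ag gk ->]] ->]|[g /allE ag ->]].
  - by exists g; rewrite ?expE ?gk.
  - by exists g; rewrite ?expE ?gk.
  - rewrite expE; case gk: (g k); [left|right]; exists (pre_exp g k) => //; by exists g.
have eB : B k = t by rewrite /target_apex kd1.
rewrite tofracD !tofracM qTe qFe.
have -> : tofrac ('X_[denominator] : {mpoly rat[N]}) = \prod_(j < d) seg_var (tile j).
  rewrite -rmorph_prod /=; congr tofrac.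
  by rewrite /denominator; elim/big_rec2: _ => [|j x y _ <-]; rewrite ?mpolyX0 ?mpolyXD.
rewrite kd big_ord_recr /= [\prod_(j < k) _ * _]mulrC mulrA -[in lam s t]eB lam_next //.
by rewrite mulrDl /lab -!/(seg_var _) /= ![_ * seg_var _ * _]mulrAC.
Qed.

Lemma state_exp_vector (K : realFieldType) g :
  matching_vector K (state_matching T s t g) = \row_i (state_exp g i)%:R.
Proof.
apply/rowP => i; rewrite !mxE; congr (_%:R).
pose F (j : 'I_d) x : nat :=
  if ~~ duplicate_side T s t j x && in_state g (val j, x) then lab j x i else 0%N.
transitivity (\sum_(j < d) \sum_x F j x)%N.
  rewrite pair_bigA /= -sum1_card big_mkcond /=; apply: eq_bigr => -[j x] _ /=.
  rewrite !inE /= /F; case: (~~ _ && in_state _ _) => //=; rewrite /lab mnm1E.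
  have sC := side_seg hT st_neq x (ltn_ord j).
  have <- : (side j x == T i) = (label_index (side j x) == i).
    by apply/eqP/eqP => [->|<-]; [apply: label_index_label|rewrite label_indexK].
  by case: (_ == _).
rewrite /state_exp mnm_sumE; apply: eq_bigr => j _.
rewrite -(pair_bigA _ (fun x y => F j (x, y))) /= !big_bool /= !mnmDE /F.
rewrite -/north -/south -/east -/west duplicate_north duplicate_east /=.
by do 4![case: ifP => _]; rewrite ?mnm0E; lia.
Qed.

End Expansion.

(** * Cluster variables *)

Section Reachability.
Variables (n : nat) (s t : 'I_n.+3).
Hypothesis st_diag : polygon_diagonal [set s; t].

Lemma diagonal_neq : s != t.
Proof. by case/andP: st_diag; rewrite cards2; case: (s != t). Qed.

(** Flipping the first crossed diagonal replaces it by one ending at [s], which does not cross [st];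
    the number of crossings drops. *)
Lemma flip_reachable (T : labelling n) : triangulation T ->
  exists (ks : seq 'I_n) (k : 'I_n), foldl (@flip n) T ks (lshift n.+3 k) = [set s; t].
Proof.
pose C (T : labelling n) := [set i : 'I_n | crosses (T (lshift n.+3 i)) [set s; t]].
have [c] := ubnP #|C T|; elim: c T => // c IH T; rewrite ltnS => Cc hT.
have st_neq := diagonal_neq; have [st|nst] := boolP (seg T s t).
  case/andP: st_diag => _ /(seg_diagonal hT st)[i <-].
  by exists [::], i.
have d0 := first_crossed hT st_neq nst.
have [eT rl h] := tileP hT st_neq d0; have qd := tile_quad hT st_neq d0.
have cr : crosses [set right_end T s t 0; left_end T s t 0] [set s; t] by rewrite crosses_st //; lia.
have [k ek] := crosses_diagonal hT rl cr; rewrite eT -ek /= in qd.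
have [|ks [k' <-]] := IH (flip T k) _ (flip_triangulation hT qd); last by exists (k :: ks), k'.
apply: leq_trans Cc; apply: proper_card; apply/properP; split.
  apply/fintype.subsetP => i; rewrite !inE (flipK hT qd) (inj_eq (@lshift_inj _ _)).
  case: eqP => // _; rewrite crosses_st // pos_self; lia.
exists k; rewrite !inE ?ek // (flipK hT qd) eqxx crosses_st // pos_self; lia.
Qed.

End Reachability.

(** * Lambda lengths along mutations *)

Section Mutations.
Variables (n : nat) (T : labelling n).
Notation V := 'I_n.+3.
Notation N := (n + n.+3).
Hypothesis hT : triangulation T.
Local Open Scope ring_scope.

Variable lam : V -> V -> ambient N.
Hypothesis lamC : forall a b, lam a b = lam b a.
Hypothesis lam_seg : forall a b, seg T a b -> lam a b = seg_var T [set a; b].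
Hypothesis lam_ptolemy : forall a b c d, ccw a b c -> ccw a c d ->
  lam a c * lam b d = lam a b * lam c d + lam a d * lam b c.

(** Forbidden pairs consist of equal bits, so alternating bits always give a matching. *)
Lemma allowed_odd (s t : V) : allowed T s t odd.
Proof. by move=> k _ /=; case: (glue_north _ _ _ _); case: (odd k). Qed.

(** Needed to divide in exchange relations. Outside [T] it follows from the expansion, whose
    numerator contains the monomial of the alternating state. *)
Lemma lam_neq0 a b : a != b -> lam a b != 0.
Proof.
move=> ab; have [sab|nab] := boolP (seg T a b).
  by rewrite lam_seg // tofrac_eq0 -msupp_eq0 msuppX.
have [q [[_ qS] e]] := state_expansion hT ab lamC lam_seg lam_ptolemy (first_crossed hT ab nab).
apply: contraTneq (_ : tofrac q != 0) => [l0|]; first by rewrite -e l0 mul0r eqxx.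
rewrite tofrac_eq0 -msupp_eq0; have := qS (state_exp T a b odd).
by case: (msupp q) => // -[_ /(_ (ex_intro2 _ _ odd (@allowed_odd a b) erefl))].
Qed.

Lemma prod_two_labels (T' : labelling n) (F : 'I_N -> ambient N) (A B : {set V}) i j :
  injective T' -> T' i = A -> T' j = B -> A != B ->
  \prod_k F k ^+ ((T' k == A) || (T' k == B)) = F i * F j.
Proof.
move=> iT <- <- ne; have ij : j != i by apply: contraNneq ne => ->.
rewrite (bigD1 i) //= eqxx expr1 (bigD1 j) //= eqxx orbT expr1 big1 ?mulr1 // => k.
by rewrite !(inj_eq iT) => /andP[/negPf-> /negPf->].
Qed.

(** The exchange relation at the flipped diagonal [ab] is the Ptolemy relation of its quadrilateral,
    so the new variable is [lam c d]; the quiver follows by [quiver_of_flip]. *)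
Lemma mutation_invariant (ks : seq 'I_n) :
  let T' := foldl (@flip n) T ks in
  let sd := foldl (fun sd j => mutate sd (lshift n.+3 j)) (initial_seed T) ks in
  [/\ triangulation T', sd.1 = quiver_of T' &
      forall i a b, T' i = [set a; b] -> sd.2 i = lam a b].
Proof.
elim/last_ind: ks => [|ks k] /=.
  split=> // i a b eT; rewrite lam_seg; last by apply/segP; exists i.
  by rewrite -eT /seg_var label_index_label.
rewrite !foldl_rcons; set T' := foldl _ T ks; set sd := foldl _ _ ks.
case: sd => q x /= [hT' -> xP]; have [a [b [c [d qd]]]] := quad_exists hT' k.
split; first exact (flip_triangulation hT' qd).
  apply/funext => i; apply/funext => j; symmetry; exact: quiver_of_flip.
move=> i u v; rewrite (flipK hT' qd); case: eqP => [_|_ /xP//] euv.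
have [eK /andP[cc1 cc2] /andP[ac cb] /andP[bd da]] := qd.
have [nac ncb nab] := ccw_neq cc1; have [nbd nda _] := ccw_neq cc2.
rewrite segC in cb; rewrite segC in da; have iT' : injective T' by case: hT'.
have /segP[i1 e1] := ac; have /segP[i2 e2] := bd.
have /segP[i3 e3] := cb; have /segP[i4 e4] := da.
have neq x' y z w : x' \notin [set z; w] -> [set x'; y] != [set z; w].
  by apply: contraNneq => <-; rewrite set21.
have -> : \prod_j x j ^+ quiver_of T' j (lshift n.+3 k) = lam a c * lam b d.
  under eq_bigr do rewrite (quiver_to_diagonal hT' qd).
  rewrite (prod_two_labels _ iT' e1 e2) ?(xP _ _ _ e1) ?(xP _ _ _ e2) //.
  by apply: neq; rewrite !inE negb_or nab eq_sym nda.
have -> : \prod_j x j ^+ quiver_of T' (lshift n.+3 k) j = lam b c * lam a d.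
  under eq_bigr do rewrite (quiver_from_diagonal hT' qd).
  rewrite (prod_two_labels _ iT' e3 e4) ?(xP _ _ _ e3) ?(xP _ _ _ e4) //.
  by apply: neq; rewrite !inE negb_or eq_sym nab nbd.
have -> : lam u v = lam c d by case/set2_eq: euv => -[-> ->].
rewrite (xP _ _ _ eK); apply: (canLR (mulfK (lam_neq0 nab))).
rewrite [RHS]mulrC (lam_ptolemy cc1 (_ : ccw a b d)); last by rewrite ccwC.
by rewrite (lamC c b) [lam b c * _]mulrC.
Qed.

(** [flip_reachable] shows that [xget] has something to choose, and [mutation_invariant] that any
    choice equals [lam s t]. *)
Lemma cluster_variableE (s t : V) : polygon_diagonal [set s; t] ->
  cluster_variable T [set s; t] = lam s t.
Proof.
move=> st; have [ks [k ek]] := flip_reachable st hT.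
have : attached T [set s; t] (cluster_variable T [set s; t]).
  by apply: xgetPex; eexists; exists ks, k; split.
move=> [ks' [k' [ek' <-]]]; have [_ _ xP] := mutation_invariant ks'.
exact: xP.
Qed.

End Mutations.

(** Two ways of writing [z] with a monomial denominator are compared by cross multiplication;
    multiplying by a monomial only translates the support. *)
Lemma laurent_exponentsE (R : realFieldType) N (z : ambient N) (q : {mpoly rat[N]})
    (m : 'X_{1..N}) : (z * tofrac 'X_[m] = tofrac q)%R ->
  laurent_exponents R z =
    (fun v => exists2 e, e \in msupp q & v = \row_i ((e i)%:R - (m i)%:R))%R.
Proof.
move=> zq; apply/seteqP; split=> [v [q' [m' [e' [zq' e'q ->]]]]|v [e eq ->]]; last first.
  by exists q, m, e.
have /eqP : tofrac (q' * 'X_[m])%R = tofrac (q * 'X_[m'])%R.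
  by rewrite !tofracM -zq -zq' mulrAC.
rewrite tofrac_eq => /eqP e.
have : (m + e')%MM \in msupp (q * 'X_[m'])%R.
  by rewrite -e (perm_mem (msuppMX _ _)) map_f.
rewrite (perm_mem (msuppMX _ _)) => /mapP[e0 e0q ee0]; exists e0 => //.
apply/rowP => i; rewrite !mxE; have /mnmP/(_ i) := ee0; 
rewrite !mnmDE => /(congr1 (fun x => x%:R : R)%R).
by rewrite !natrD => h; apply/eqP; rewrite subr_eq addrAC eq_sym subr_eq addrC -h addrC.
Qed.

Theorem theorem4p13 (R : realFieldType) (n : nat) (T : labelling n)
    (s t : 'I_n.+3) :
  triangulation T ->
  polygon_diagonal [set s; t]%SET ->
  (forall i, T i <> [set s; t]%SET) ->
  order_isomorphic
    (face (newton_polytope R (cluster_variable T [set s; t]%SET)))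
    (fun F F' => F `<=` F')%classic
    (elementary (snake_graph T s t))
    (fun H H' => H \subset H') /\
  order_isomorphic
    (face (matching_polytope T s t R))
    (fun F F' => F `<=` F')%classic
    (elementary (snake_graph T s t))
    (fun H H' => H \subset H').
Proof.
move=> hT st_diag stT; have st_neq := diagonal_neq st_diag.
have nst : ~~ seg T s t by apply/segP => -[i /stT].
have d0 := first_crossed hT st_neq nst.
have faces (w : 'rV[R]_(n + n.+3)) := snake_face_lattice w d0
  (unique_first_label hT st_neq d0) (unique_glue_label hT st_neq).
split; last first.
  have := faces 0%R; rewrite /matching_polytope.
  have -> : (fun x => exists2 M : {set gedge (snake_graph T s t)}, pm M &
      x = matching_vector R M + 0)%R =
      (fun x => exists2 M : {set gedge (snake_graph T s t)}, pm M & x = matching_vector R M).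
    by apply/funext => x; congr ex2; apply/funext => M; rewrite addr0.
  exact.
have x_neq0 i : seg_var T (T i) != 0%R by rewrite tofrac_eq0 -msupp_eq0 msuppX.
have [lam [lamC lam_seg lam_ptolemy]] := lambda_lengths hT x_neq0.
rewrite (cluster_variableE hT lamC lam_seg lam_ptolemy st_diag).
have [q [[_ qS] eq]] := state_expansion hT st_neq lamC lam_seg lam_ptolemy d0.
rewrite /newton_polytope (laurent_exponentsE R eq).
set X := (X in convex_hull X).
suff -> : X = (fun x => exists2 M : {set gedge (snake_graph T s t)}, pm M &
    x = matching_vector R M - \row_i (denominator T s t i)%:R)%R by exact: faces.
apply/seteqP; split=> [x [e /qS[g ag ->] ->]|x [M /state_of_pm[g ag ->] ->]].
  exists (state_matching T s t g); first exact: pm_state_matching.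
  by rewrite state_exp_vector //; apply/rowP => i; rewrite !mxE.
exists (state_exp T s t g); first by apply/qS; exists g.
by rewrite state_exp_vector //; apply/rowP => i; rewrite !mxE.
Qed.
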